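(* Let $M$ and $N$ be metrizable spaces and let $X\subset M$ and $Y\subset N$ be closed homotopy negligible subsets. If $M\setminus X$ and $N\setminus Y$ are $X$-$Y$-approaching homotopy equivalent, then $X$ and $Y$ are fine shape equivalent.
   Context: Maps are continuous, $I=[0,1]$. A subset $X$ of a space $M$ is homotopy negligible in $M$ if there is a homotopy $h_t\colon M\to M$ with $h_0=\mathrm{id}$ and $h_t(M)\subset M\setminus X$ for all $t>0$. If $X\subset M$ and $Y\subset N$ are closed subsets of metrizable spaces, a map $f\colon M\setminus X\to N\setminus Y$ is $X$-$Y$-approaching if it sends every sequence having a cluster point in $X$ to a sequence having a cluster point in $Y$. An $X$-$Y$-approaching homotopy is a homotopy $(M\setminus X)\times I\to N\setminus Y$ that is an $(X\times I)$-$Y$-approaching map. $M\setminus X$ and $N\setminus Y$ are $X$-$Y$-approaching homotopy equivalent if there are an $X$-$Y$-approaching map $f\colon M\setminus X\to N\setminus Y$ and a $Y$-$X$-approaching map $g\colon N\setminus Y\to M\setminus X$ such that $gf$ is $X$-$X$-approaching homotopic to $\mathrm{id}_{M\setminus X}$ and $fg$ is $Y$-$Y$-approaching homotopic to $\mathrm{id}_{N\setminus Y}$. Fine shape category. Absolute retracts (ARs) are those for metrizable spaces. A Z-set in an AR is a closed homotopy negligible subset. Every metrizable space embeds as a Z-set in some AR. If $X$, $Y$ are Z-sets in ARs $M$, $N$ and $\varphi\colon X\to Y$ is a map, $\varphi_{MN}\colon M\setminus X\to N\setminus Y$ denotes an $X$-$Y$-approaching map combining with $\varphi$ into a continuous map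 $M\to N$ (it exists and is unique up to $X$-$Y$-approaching homotopy). The objects of the fine shape category are metrizable spaces. $X$-$Y$-approaching maps $\Phi\colon M\setminus X\to N\setminus Y$ and $\Phi'\colon M'\setminus X\to N'\setminus Y$ (with $X$ a Z-set in ARs $M,M'$ and $Y$ a Z-set in ARs $N,N'$) represent the same fine shape morphism $X\to Y$ if $(\mathrm{id}_Y)_{NN'}\Phi$ and $\Phi'(\mathrm{id}_X)_{MM'}$ are $X$-$Y$-approaching homotopic; fine shape morphisms are the equivalence classes, and composition is induced by composition of representatives $M\setminus X\to N\setminus Y\to L\setminus Z$. Metrizable spaces are fine shape equivalent if they are isomorphic in the fine shape category. *)

(* Defs.v *)
From HB Require Import structures.
From mathcomp Require Import all_boot all_order all_algebra.
From mathcomp Require Import all_classical all_reals topology num_normedtype.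

Set Implicit Arguments.
Unset Strict Implicit.
Unset Printing Implicit Defensive.

Import Order.TTheory GRing.Theory Num.Theory.
Import numFieldTopology.Exports.

Local Open Scope classical_set_scope.
Local Open Scope ring_scope.

(* A set [A : set T] coerces to the sigma type [set_type A], which carries the
   subset topology; so [~` X] used as a type is the space M \ X, and [set_val]
   is the inclusion. *)

Definition metrizable (R : realType) (M : topologicalType) : Prop :=
  exists d : M -> M -> R,
    [/\ forall x y, d x y = 0 <-> x = y,
        forall x y, d x y = d y x,
        forall x y z, d x z <= d x y + d y z
      & forall (x : M) (U : set M),
          nbhs x U <-> exists2 e : R, 0 < e & [set y | d x y < e] `<=` U].

Definition unit_interval (R : realType) : topologicalType :=
  set_type (`[0, 1]%classic : set R).

Lemma zero_in_I (R : realType) : (0 : R) \in (`[0, 1]%classic : set R).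
Proof. by rewrite inE /= in_itv /= lexx ler01. Qed.

Lemma one_in_I (R : realType) : (1 : R) \in (`[0, 1]%classic : set R).
Proof. by rewrite inE /= in_itv /= lexx ler01. Qed.

Definition I0 (R : realType) : unit_interval R := exist _ (0 : R) (zero_in_I R).
Definition I1 (R : realType) : unit_interval R := exist _ (1 : R) (one_in_I R).

Definition homotopy_negligible (R : realType) (M : topologicalType)
    (X : set M) : Prop :=
  exists h : (M * unit_interval R)%type -> M,
    [/\ continuous h,
        forall x, h (x, I0 R) = x
      & forall x t, 0 < set_val t -> ~ X (h (x, t))].

Definition clusters_in (M : topologicalType) (X : set M) (u : nat -> M) : Prop :=
  exists2 x, X x & cluster (u @ \oo) x.

Section Approaching.
Variables (M N : topologicalType) (X : set M) (Y : set N).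

Definition approaching (f : ~` X -> ~` Y) : Prop :=
  continuous f /\
  forall u : nat -> ~` X,
    clusters_in X (set_val \o u) -> clusters_in Y (set_val \o f \o u).

(* [(~` X) * I] is identified with the complement of [X `*` I] in [M * I]. *)
Definition approaching_homotopy (R : realType)
    (H : (~` X * unit_interval R)%type -> ~` Y) : Prop :=
  continuous H /\
  forall u : nat -> (~` X * unit_interval R)%type,
    clusters_in (X `*` [set: unit_interval R])
                (fun n => (set_val (u n).1, (u n).2)) ->
    clusters_in Y (set_val \o H \o u).

Definition approaching_homotopic (R : realType) (f g : ~` X -> ~` Y) : Prop :=
  exists H : (~` X * unit_interval R)%type -> ~` Y,
    [/\ approaching_homotopy H,
        forall p, H (p, I0 R) = f p
      & forall p, H (p, I1 R) = g p].

End Approaching.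

Definition approaching_homotopy_equivalent (R : realType)
    (M N : topologicalType) (X : set M) (Y : set N) : Prop :=
  exists (f : ~` X -> ~` Y) (g : ~` Y -> ~` X),
    [/\ approaching f, approaching g,
        approaching_homotopic R (g \o f) idfun
      & approaching_homotopic R (f \o g) idfun].

Definition embedding (S T : topologicalType) (e : S -> T) : Prop :=
  injective e /\
  forall U : set S, open U <-> exists2 V : set T, open V & U = e @^-1` V.

Definition absolute_retract (R : realType) (M : topologicalType) : Prop :=
  metrizable R M /\
  forall (Z : topologicalType) (e : M -> Z),
    metrizable R Z -> embedding e -> closed (range e) ->
    exists2 r : Z -> M, continuous r & cancel e r.

(* A copy of X as a Z-set in an AR. *)
Record z_embedding (R : realType) (X : topologicalType) := ZEmbedding {
  z_space :> topologicalType;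
  z_map : X -> z_space;
  z_spaceAR : absolute_retract R z_space;
  z_mapE : embedding z_map;
  z_closed : closed (range z_map);
  z_negligible : homotopy_negligible R (range z_map)
}.
Arguments z_map {R X} _ _.

Definition z_set (R : realType) (X : topologicalType) (A : z_embedding R X) :
  set A := range (z_map A).
Arguments z_set {R X} _ _.

Section Realizes.
Variables (R : realType) (X Y : topologicalType).
Variables (A : z_embedding R X) (B : z_embedding R Y).

(* F is a choice of phi_AB. *)
Definition realizes (phi : X -> Y) (F : ~` z_set A -> ~` z_set B) : Prop :=
  approaching F /\
  exists G : A -> B,
    [/\ continuous G,
        forall x, G (z_map A x) = z_map B (phi x)
      & forall p, G (set_val p) = set_val (F p)].

End Realizes.

Record fine_rep (R : realType) (X Y : topologicalType) := FineRep {
  rep_src : z_embedding R X;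
  rep_tgt : z_embedding R Y;
  rep_map : ~` z_set rep_src -> ~` z_set rep_tgt;
  rep_approaching : approaching rep_map
}.
Arguments rep_map {R X Y} _ _.

Definition same_fine_morphism (R : realType) (X Y : topologicalType)
    (P Q : fine_rep R X Y) : Prop :=
  exists (a : ~` z_set (rep_src P) -> ~` z_set (rep_src Q))
         (b : ~` z_set (rep_tgt P) -> ~` z_set (rep_tgt Q)),
    [/\ realizes idfun a, realizes idfun b
      & approaching_homotopic R (b \o rep_map P) (rep_map Q \o a)].

Record fine_morphism (R : realType) (X Y : topologicalType) := FineMorphism {
  fine_class :> fine_rep R X Y -> Prop;
  fine_classP : exists P, forall Q, fine_class Q <-> same_fine_morphism P Q
}.

Lemma approaching_id (M : topologicalType) (X : set M) :
  approaching (idfun : ~` X -> ~` X).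
Proof. by split=> // x U. Qed.

Lemma approaching_comp (L M N : topologicalType)
    (X : set L) (Y : set M) (Z : set N)
    (f : ~` X -> ~` Y) (g : ~` Y -> ~` Z) :
  approaching f -> approaching g -> approaching (g \o f).
Proof.
move=> [cf af] [cg ag]; split; last by move=> u /af /(ag (f \o u)).
by move=> x; apply: continuous_comp; [exact: cf|exact: cg].
Qed.

Definition id_rep (R : realType) (X : topologicalType) (A : z_embedding R X) :
  fine_rep R X X := FineRep (@approaching_id A (z_set A)).

Definition fine_id (R : realType) (X : topologicalType) : fine_rep R X X -> Prop :=
  fun Q => exists A : z_embedding R X, same_fine_morphism (id_rep A) Q.

(* The class of the composites of all representatives of f and g that share
   the middle space. *)
Definition fine_comp (R : realType) (X Y Z : topologicalType)
    (g : fine_morphism R Y Z) (f : fine_morphism R X Y) :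
    fine_rep R X Z -> Prop :=
  fun Q => exists (A : z_embedding R X) (B : z_embedding R Y)
      (C : z_embedding R Z)
      (F : ~` z_set A -> ~` z_set B) (G : ~` z_set B -> ~` z_set C)
      (aF : approaching F) (aG : approaching G),
    [/\ f (FineRep aF), g (FineRep aG)
      & same_fine_morphism (FineRep (approaching_comp aF aG)) Q].

Definition fine_shape_equivalent (R : realType) (X Y : topologicalType) : Prop :=
  exists (f : fine_morphism R X Y) (g : fine_morphism R Y X),
    (forall Q, fine_comp g f Q <-> fine_id Q) /\
    (forall Q, fine_comp f g Q <-> fine_id Q).

(* Main.v *)
(* Every metrizable M is a Z-set in an absolute retract: let C(M) be the set of
   functions p : {None} + M -> [0, 1], with the sup metric, such that
   p None = 0 implies that p restricts on M to the distance function of some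
   point.  Hausdorff's formula extends maps from closed subsets into function
   cubes, hence into C(M) (raise the coordinate None off the closed subset), and
   M = {p None = 0} is a Z-set in C(M).  A retraction of C(B) onto an AR B shows
   that B is an absolute extensor.

   Let A = C(M) and B = C(N), containing X and Y as Z-sets.  The homotopy of M
   off X extends to a homotopy H of A off X.  For an approaching map
   M \ X -> B \ Y with a continuous extension Phi : A \ X -> B \ Y, the good
   behaviour of Phi near M \ X and compactness of [1/n, 1] give a function tau
   vanishing exactly on X such that z |-> Phi (H (z, tau z)) is approaching.
   So every approaching map M \ X -> B \ Y extends up to approaching homotopy
   to A \ X, uniquely by the same argument with a parameter in [0, 1].  The
   extensions F, G of the given mutually inverse equivalences are therefore
   inverse to each other and represent inverse fine shape morphisms. *)

From HB Require Import structures.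
Require Import Defs.
From mathcomp Require Import all_boot all_order all_algebra.
From mathcomp Require Import all_classical all_reals topology normedtype.
From mathcomp Require Import interval_inference ring lra.

Set Implicit Arguments.
Unset Strict Implicit.
Unset Printing Implicit Defensive.

Import Order.TTheory GRing.Theory Num.Theory.
Import numFieldTopology.Exports numFieldNormedType.Exports.

Local Open Scope classical_set_scope.
Local Open Scope ring_scope.

(** * Metrics and Hausdorff's extension formula *)

(** The body of [metrizable] as a predicate on a chosen [d], so that [metrizable R M] unfolds to the
    existence of some [d] with [is_metric d]. *)
Definition is_metric (R : realType) (M : topologicalType) (d : M -> M -> R) :=
  [/\ forall x y, d x y = 0 <-> x = y,
      forall x y, d x y = d y x,
      forall x y z, d x z <= d x y + d y z
    & forall (x : M) (U : set M),
        nbhs x U <-> exists2 e : R, 0 < e & [set y | d x y < e] `<=` U].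

Section Metric.
Variables (R : realType) (T : topologicalType) (d : T -> T -> R).
Hypothesis hd : is_metric d.

Lemma metric_eq0 x y : d x y = 0 -> x = y.
Proof. by case: hd => h _ _ _ /h. Qed.

Lemma metricxx x : d x x = 0.
Proof. by case: hd => h _ _ _; apply/h. Qed.

Lemma metricC x y : d x y = d y x.
Proof. by case: hd. Qed.

Lemma metric_tri x y z : d x z <= d x y + d y z.
Proof. by case: hd. Qed.

Lemma metric_ge0 x y : 0 <= d x y.
Proof. by have := metric_tri x y x; rewrite metricxx (metricC y x); lra. Qed.

Lemma nbhs_metricP x U :
  nbhs x U <-> exists2 e : R, 0 < e & [set y | d x y < e] `<=` U.
Proof. by case: hd. Qed.

Lemma near_metric x e : 0 < e -> \forall y \near x, d x y < e.
Proof. by move=> e0; apply/nbhs_metricP; exists e. Qed.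

Lemma cvg_metricP (S : Type) (F : set_system S) (FF : Filter F)
    (f : S -> T) y :
  f @ F --> y <-> forall e : R, 0 < e -> \forall s \near F, d y (f s) < e.
Proof.
split=> [fy e e0|h U /nbhs_metricP[e e0 eU]].
  by apply: (fy [set z | d y z < e]); exact: near_metric.
by apply: filterS (h e e0) => s /eU.
Qed.

Lemma bounded_metric :
  is_metric (fun x y => Num.min 1 (d x y)).
Proof.
split=> [x y|x y|x y z|x U].
- split=> [|->]; last by rewrite metricxx min_r.
  rewrite /Num.min; case: ifP => _ h; last exact: metric_eq0.
  by exfalso; lra.
- by rewrite metricC.
- have := metric_tri x y z; have := metric_ge0 x y; have := metric_ge0 y z.
  by rewrite /Num.min; do !case: ifPn; rewrite -?leNgt; lra.
rewrite nbhs_metricP; split=> -[e e0 eU].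
  exists (Num.min 1 e) => [|y /= hy]; first by rewrite lt_min ltr01.
  apply: eU => /=; move: hy.
  by rewrite /Num.min; do !case: ifPn; rewrite -?leNgt; lra.
exists e => // y /= hy; apply: eU => /=; move: hy.
by rewrite /Num.min; do !case: ifPn; rewrite -?leNgt; lra.
Qed.

End Metric.

Lemma real_metric (R : realType) :
  is_metric (fun x y : R => `|x - y|).
Proof.
split=> [x y|x y|x y z|x U].
- by split=> [/normr0_eq0/subr0_eq//|->]; rewrite subrr normr0.
- exact: distrC.
- exact: ler_distD.
exact: (@nbhs_ballP R R x U).
Qed.

Section Gap.
Variables (R : realType) (T : topologicalType) (d : T -> T -> R).
Hypothesis hd : is_metric d.
Variable C : set T.

(** The distance to [C] truncated at 1. The added element 1 keeps the infimum over a nonempty set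
    even if [C] is empty, when the gap is constantly 1. *)
Definition gap (z : T) : R := inf (1 |` [set d z c | c in C]).

Let gap_lb z : has_lbound (1 |` [set d z c | c in C]).
Proof. by exists 0 => _ [->|[c _ <-]]; [exact: ler01|exact: metric_ge0]. Qed.

Let gap_inf z : has_inf (1 |` [set d z c | c in C]).
Proof. by split; [exists 1; left|]. Qed.

Lemma gap_ge0 z : 0 <= gap z.
Proof.
apply: lb_le_inf; first by exists 1; left.
by move=> _ [->|[c _ <-]]; [exact: ler01|exact: metric_ge0].
Qed.

Lemma gap_le1 z : gap z <= 1.
Proof. by apply: ge_inf => //; left. Qed.

Lemma gap_le z c : C c -> gap z <= d z c.
Proof. by move=> Cc; apply: ge_inf => //; right; exists c. Qed.

Lemma gap0 z : C z -> gap z = 0.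
Proof.
by move=> Cz; have := gap_le z Cz; have := gap_ge0 z; rewrite (metricxx hd); lra.
Qed.

Lemma gap_lt z e : e <= 1 -> gap z < e -> exists2 c, C c & d z c < e.
Proof.
move=> e1 /(inf_lt (gap_inf z).1)[_ [->|[c Cc <-]] h]; last by exists c.
by move: h; lra.
Qed.

Lemma gap_lip z y : gap z <= gap y + d z y.
Proof.
rewrite -lerBlDr; apply: lb_le_inf; first by exists 1; left.
move=> _ [->|[c Cc <-]].
  by have := gap_le1 z; have := metric_ge0 hd z y; lra.
by have := gap_le z Cc; have := metric_tri hd z y c; lra.
Qed.

Lemma gap_gt0 z : closed C -> ~ C z -> 0 < gap z.
Proof.
move=> cC nCz; rewrite lt_neqAle gap_ge0 andbT; apply/eqP => g0.
apply: nCz; apply: cC => U /(nbhs_metricP hd)[e e0 eU].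
have [||c Cc hc] := @gap_lt z (Num.min 1 e).
- by rewrite ge_min lexx.
- by rewrite -g0 lt_min ltr01.
by exists c; split=> //; apply: eU => /=; move: hc; rewrite lt_min => /andP[].
Qed.

Lemma gap_continuous : continuous gap.
Proof.
move=> z; apply/(cvg_metricP (real_metric R)) => e e0.
apply: filterS (near_metric hd z e0) => y /= hy.
have := gap_lip z y; have := gap_lip y z; rewrite (metricC hd y z) => h1 h2.
by rewrite ltr_distl; apply/andP; split; lra.
Qed.

End Gap.

Section HausdorffExtension.
Variables (R : realType) (Z : topologicalType) (d : Z -> Z -> R) (C : set Z).
Hypotheses (hd : is_metric d) (cC : closed C).
Variables (I : Type) (g : Z -> I -> R).
Hypothesis g01 : forall z i, 0 <= g z i <= 1.
Hypothesis g_cont : forall z e, C z -> 0 < e -> exists2 r, 0 < r &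
  forall c, C c -> d z c < r -> forall i, `|g z i - g c i| <= e.

Let D := gap d C.

Let num z c := Num.max 0 (Num.min (3 * D z - d z c) (D z)).

(* The weight of c is 1 if d z c <= 2 D z, and 0 if d z c >= 3 D z. *)
Let w z c := num z c / D z.

Let D_ge0 z : 0 <= D z. Proof. exact: gap_ge0. Qed.

Let num_itv z c : 0 <= num z c <= D z.
Proof.
rewrite /num le_max lexx /=; have := D_ge0 z.
by rewrite /Num.max /Num.min; do !case: ifPn; rewrite -?leNgt; lra.
Qed.

Let w_itv z c : ~ C z -> 0 <= w z c <= 1.
Proof.
move=> nCz; have Dz : 0 < D z by exact: gap_gt0.
have /andP[n0 nD] := num_itv z c.
by rewrite divr_ge0 ?D_ge0//= ler_pdivrMr// mul1r.
Qed.

Let num_lip z y c : `|num z c - num y c| <= 4 * d z y.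
Proof.
have := gap_lip hd C z y; have := gap_lip hd C y z.
have := metric_tri hd z y c; have := metric_tri hd y z c.
have := metric_ge0 hd z y; rewrite /num -/D (metricC hd y z).
rewrite ler_distl /Num.max /Num.min.
by do !case: ifPn; rewrite -?leNgt => *; apply/andP; split; lra.
Qed.

Let w_lip z y c : ~ C z -> ~ C y -> `|w z c - w y c| <= 5 * d z y / D z.
Proof.
move=> nCz nCy; have Dz : 0 < D z by exact: gap_gt0.
have Dy : 0 < D y by exact: gap_gt0.
(* Since [num y c = w y c * D y], changing the denominator costs [w y c * (D y - D z)], at most
   [d z y]. Together with the constant 4 for [num] this gives 5. *)
have -> : w z c - w y c =
    ((num z c - num y c) + w y c * (D y - D z)) / D z.
  by rewrite /w; field; rewrite !gt_eqF.
rewrite normrM [X in _ * X]ger0_norm ?invr_ge0 ?D_ge0//.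
rewrite ler_wpM2r ?invr_ge0 ?D_ge0//; apply: le_trans (ler_normD _ _) _.
have hD : `|D y - D z| <= d z y.
  have := gap_lip hd C z y; have := gap_lip hd C y z.
  by rewrite ler_distl (metricC hd y z) /D; lra.
have : `|w y c * (D y - D z)| <= d z y.
  rewrite normrM; apply: le_trans hD; rewrite ler_piMl//.
  by have /andP[w0 w1] := w_itv c nCy; rewrite ger0_norm.
have := num_lip z y c; lra.
Qed.

Let G z i := if pselect (C z) then g z i
  else sup (0 |` [set w z c * g c i | c in C]).

Let S z i := 0 |` [set w z c * g c i | c in C].

Let S_ub z i : ~ C z -> ubound (S z i) 1.
Proof.
move=> nCz _ [->|[c _ <-]]; first exact: ler01.
have /andP[w0 w1] := w_itv c nCz; have /andP[g0 g1] := g01 c i.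
exact: mulr_ile1.
Qed.

Let S_sup z i : ~ C z -> has_sup (S z i).
Proof. by move=> nCz; split; [exists 0; left|exists 1; exact: S_ub]. Qed.

Let supS_ge0 z i : ~ C z -> 0 <= sup (S z i).
Proof. by move=> nCz; apply: sup_upper_bound; [exact: S_sup|left]. Qed.

(** Off [C] the extension is the weighted supremum of the values on [C]. Near [C] only nearby points
    of [C] have nonzero weight, and one of them has weight 1; away from [C] the bound [w_lip] on the
    weights suffices. All estimates are uniform in the index, as the sup metric on the cone
    requires. *)
Lemma hausdorff_extension : exists G : Z -> I -> R,
  [/\ forall z i, 0 <= G z i <= 1,
      forall z, C z -> G z = g z
    & forall z e, 0 < e -> exists2 r, 0 < r &
        forall y, d z y < r -> forall i, `|G z i - G y i| <= e].
Proof.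
exists G; split=> [z i|z Cz|z e e0].
- rewrite /G; case: pselect => [Cz|nCz]; first exact: g01.
  rewrite -/(S z i) supS_ge0//=.
  by apply: ge_sup; [exists 0; left|exact: S_ub].
- by apply/funext => i; rewrite /G; case: pselect.
have [Cz|nCz] := pselect (C z).
  have [r r0 hr] := g_cont Cz e0.
  (* As [D y <= d z y < r / 4], points within [3 * D y] of [y] are within [r] of [z]. The bound 1/2
     keeps [D y] below 1, so the truncation of the gap has no effect and some point of [C] lies
     within [2 * D y]. *)
  exists (Num.min (r / 4) (1 / 2)) => [|y].
    by rewrite lt_min !divr_gt0.
  rewrite lt_min => /andP[hy1 hy2] i; rewrite /G.
  case: pselect => // Cz'; case: pselect => [Cy|nCy].
    by apply: hr => //; move: hy1; lra.
  have Dy : 0 < D y by exact: gap_gt0.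
  have Dzy : D y <= d z y by rewrite (metricC hd); exact: gap_le.
  have close c : C c -> d y c < 3 * D y -> `|g z i - g c i| <= e.
    by move=> Cc hc; apply: hr => //; have := metric_tri hd z y c; lra.
  rewrite ler_distlC; apply/andP; split.
    (* Lower bound: a point of [C] within [2 * D y] has weight 1, so its value enters the supremum
       unchanged. *)
    have [||c Cc hc] := @gap_lt _ _ d hd C y (Num.min 1 (2 * D y)).
    - by rewrite ge_min lexx.
    - by rewrite lt_min -/(D y); apply/andP; split; lra.
    move: hc; rewrite lt_min => /andP[_ hc].
    have wc : w y c = 1.
      rewrite /w /num min_r; last by lra.
      by rewrite max_r ?divff ?gt_eqF// ltW.
    have : g c i <= sup (S y i).
      apply: sup_upper_bound; first exact: S_sup.
      by right; exists c => //; rewrite wc mul1r.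
    have : `|g z i - g c i| <= e by apply: close => //; lra.
    by rewrite ler_distlC -/(S y i); lra.
  (* Upper bound: points beyond [3 * D y] have weight 0, and the others have values at most
     [g z i + e] and weights at most 1. *)
  apply: ge_sup; first by exists 0; left.
  have /andP[gz0 gz1] := g01 z i.
  move=> _ [->|[c Cc <-]]; first by lra.
  have /andP[gc0 gc1] := g01 c i.
  have [hc|hc] := ltP (d y c) (3 * D y).
    have := close c Cc hc; rewrite ler_distlC => /andP[_ h].
    apply: le_trans h; rewrite ler_piMl//.
    by have /andP[] := w_itv c nCy.
  have -> : w y c = 0.
    by rewrite /w /num min_l ?max_l ?mul0r//; lra.
  by rewrite mul0r; lra.
have Dz : 0 < D z by exact: gap_gt0.
(* The bound [D z] keeps [y] off [C]; the other one makes the estimate of [w_lip] at most [e]. *)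
exists (Num.min (D z) (e * D z / 5)) => [|y].
  by rewrite lt_min Dz divr_gt0// mulr_gt0.
rewrite lt_min => /andP[hy1 hy2] i.
have nCy : ~ C y by move=> /(gap_le hd z); rewrite -/(D z); lra.
rewrite /G; case: pselect => // nCz'; case: pselect => // nCy'.
have he : 5 * d z y / D z <= e.
  by rewrite ler_pdivrMr//; lra.
have close c : C c -> `|w z c * g c i - w y c * g c i| <= e.
  move=> Cc; rewrite -mulrBl normrM; apply: le_trans he.
  apply: le_trans (w_lip c nCz nCy); rewrite ler_piMr//.
  by have /andP[g0 g1] := g01 c i; rewrite ger0_norm.
rewrite -/(S z i) -/(S y i) ler_distl; apply/andP; split.
  rewrite lerBlDr; apply: ge_sup; first by exists 0; left.
  move=> _ [->|[c Cc <-]]; first by have := supS_ge0 i nCz; lra.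
  have := close c Cc; rewrite ler_distl => /andP[h _].
  suff : w z c * g c i <= sup (S z i) by lra.
  by apply: sup_upper_bound; [exact: S_sup|right; exists c].
apply: ge_sup; first by exists 0; left.
move=> _ [->|[c Cc <-]]; first by have := supS_ge0 i nCy; lra.
have := close c Cc; rewrite ler_distl => /andP[_ h].
suff : w y c * g c i <= sup (S y i) by lra.
by apply: sup_upper_bound; [exact: S_sup|right; exists c].
Qed.

End HausdorffExtension.

(** * Products, subspaces and embeddings of metric spaces *)

Lemma continuous_pair (S T U : topologicalType) (f : S -> T) (g : S -> U) :
  continuous f -> continuous g -> continuous (fun x => (f x, g x)).
Proof. by move=> cf cg x; apply: cvg_pair; [exact: cf|exact: cg]. Qed.

Lemma continuous_fst (S T : topologicalType) :
  continuous (fst : S * T -> S).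
Proof. by move=> x; exact: cvg_fst. Qed.

Lemma continuous_snd (S T : topologicalType) :
  continuous (snd : S * T -> T).
Proof. by move=> x; exact: cvg_snd. Qed.

Lemma comp_continuous (S T U : topologicalType) (f : S -> T) (g : T -> U) :
  continuous f -> continuous g -> continuous (g \o f).
Proof. by move=> cf cg x; apply: continuous_comp; [exact: cf|exact: cg]. Qed.

Lemma metric_prod (R : realType) (S T : topologicalType) (d1 : S -> S -> R)
    (d2 : T -> T -> R) : is_metric d1 -> is_metric d2 ->
  is_metric (fun p q : S * T => Num.max (d1 p.1 q.1) (d2 p.2 q.2)).
Proof.
move=> h1 h2; split=> [[x s] [y t]|[x s] [y t]|[x s] [y t] [z u]|[x s] U] /=.
- split=> [h|[-> ->]]; last by rewrite !(metricxx h1, metricxx h2) maxxx.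
  have := metric_ge0 h1 x y; have := metric_ge0 h2 s t; move: h.
  rewrite /Num.max; case: ifPn; rewrite -?leNgt => ? h ? ?.
    by congr (_, _); [apply: (metric_eq0 h1)|apply: (metric_eq0 h2)]; lra.
  by congr (_, _); [apply: (metric_eq0 h1)|apply: (metric_eq0 h2)]; lra.
- by rewrite (metricC h1) (metricC h2).
- have := metric_tri h1 x y z; have := metric_tri h2 s t u.
  by rewrite /Num.max; do !case: ifPn; rewrite -?leNgt; lra.
split=> [[[/= P Q] [/= xP sQ] PQU]|[e e0 eU]].
  have [e1 e10 eP] := (nbhs_metricP h1 _ _).1 xP.
  have [e2 e20 eQ] := (nbhs_metricP h2 _ _).1 sQ.
  exists (Num.min e1 e2) => [|[y t] /=]; first by rewrite lt_min e10.
  rewrite gt_max !lt_min => /andP[/andP[? ?] /andP[? ?]].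
  by apply: PQU; split; [exact: eP|exact: eQ].
exists ([set y | d1 x y < e], [set t | d2 s t < e]).
  by split; exact: near_metric.
by move=> [y t] /= [hy ht]; apply: eU => /=; rewrite gt_max hy.
Qed.

Lemma set_val_inj (T : Type) (A : set T) : injective (set_val : A -> T).
Proof. by move=> x y; exact: val_inj. Qed.

Lemma set_val_continuous (T : topologicalType) (A : set T) :
  continuous (set_val : A -> T).
Proof. exact: initial_continuous. Qed.

Lemma continuous_set_type (S T : topologicalType) (A : set T) (f : S -> A) :
  continuous (set_val \o f) -> continuous f.
Proof. exact: continuous_comp_initial. Qed.

Lemma nbhs_set_type (T : topologicalType) (A : set T) (x : A) (U : set A) :
  nbhs x U <-> exists2 V, nbhs (set_val x) V & set_val @^-1` V `<=` U.
Proof.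
split=> [[_ [[W oW <-] Wx] WU]|[V xV VU]].
  by exists W => //; exact: open_nbhs_nbhs.
by apply: filterS VU _; apply: set_val_continuous.
Qed.

Lemma metric_sub (R : realType) (T : topologicalType) (d : T -> T -> R)
    (A : set T) : is_metric d ->
  is_metric (fun x y : A => d (set_val x) (set_val y)).
Proof.
move=> hd; split=> [x y|x y|x y z|x U].
- split=> [/(metric_eq0 hd)/val_inj//|->]; exact: metricxx.
- exact: metricC.
- exact: metric_tri.
rewrite nbhs_set_type; split=> [[V /(nbhs_metricP hd)[e e0 eV] VU]|[e e0 eU]].
  by exists e => // y /= hy; apply: VU; exact: eV.
by exists [set y | d (set_val x) y < e] => //; exact: near_metric.
Qed.

Lemma metrizable_prod (R : realType) (S T : topologicalType) :
  metrizable R S -> metrizable R T -> metrizable R (S * T)%type.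
Proof.
by move=> [d1 h1] [d2 h2]; eexists; exact: (metric_prod h1 h2).
Qed.

Lemma metrizable_sub (R : realType) (T : topologicalType) (A : set T) :
  metrizable R T -> metrizable R A.
Proof. by move=> [d hd]; eexists; exact: (metric_sub _ hd). Qed.

Lemma metrizable_interval (R : realType) : metrizable R (unit_interval R).
Proof. by apply: metrizable_sub; eexists; exact: real_metric. Qed.

Lemma within_eq (S T : topologicalType) (A : set S) (u v : S -> T) :
  (forall x, A x -> u x = v x) -> {within A, continuous u} ->
  {within A, continuous v}.
Proof.
move=> uv; apply: subspace_eq_continuous => x /set_mem; exact: uv.
Qed.

Lemma closed_preimage (S T : topologicalType) (u : S -> T) (D : set T) :
  continuous u -> closed D -> closed (u @^-1` D).
Proof. by move=> /continuous_closedP; apply. Qed.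

Lemma within_metricP (R : realType) (S T : topologicalType)
    (d : S -> S -> R) (d' : T -> T -> R) (A : set S) (f : S -> T) :
  is_metric d -> is_metric d' ->
  {within A, continuous f} <->
  forall x e, A x -> 0 < e -> exists2 r, 0 < r &
    forall y, A y -> d x y < r -> d' (f x) (f y) < e.
Proof.
move=> hd hd'; rewrite subspace_continuousP; split=> [h x e Ax e0|h x Ax].
  have /(cvg_metricP hd')/(_ e e0) := h x Ax.
  move=> /(nbhs_metricP hd)[r r0 hr]; exists r => // y Ay yr.
  exact: hr.
apply/(cvg_metricP hd') => e e0; have [r r0 hr] := h x e Ax e0.
by apply/(nbhs_metricP hd); exists r => // y yr Ay; exact: hr.
Qed.

Lemma continuous_metricP (R : realType) (S T : topologicalType)
    (d : S -> S -> R) (d' : T -> T -> R) (f : S -> T) :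
  is_metric d -> is_metric d' ->
  continuous f <->
  forall x e, 0 < e -> exists2 r, 0 < r &
    forall y, d x y < r -> d' (f x) (f y) < e.
Proof.
move=> hd hd'; rewrite continuous_subspace_setT (within_metricP _ _ hd hd').
split=> h x e.
  by move=> /(h x e Logic.I)[r r0 hr]; exists r => // y; exact: hr.
by move=> _ /(h x e)[r r0 hr]; exists r => // y _; exact: hr.
Qed.

Lemma embedding_continuous (S T : topologicalType) (e : S -> T) :
  embedding e -> continuous e.
Proof. by move=> [_ he]; apply/continuousP => V oV; apply/he; exists V. Qed.

Lemma embedding_nbhs (S T : topologicalType) (e : S -> T) x U :
  embedding e -> nbhs x U -> exists2 V, nbhs (e x) V & e @^-1` V `<=` U.
Proof.
move=> [_ he]; rewrite nbhsE => -[W [/he[V oV ->] Vx] WU].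
by exists V => //; exact: open_nbhs_nbhs.
Qed.

Lemma embedding_cvg (S T : topologicalType) (e : S -> T) (I : Type)
    (F : set_system I) (FF : Filter F) (u : I -> S) x :
  embedding e -> e \o u @ F --> e x -> u @ F --> x.
Proof.
move=> he eu U /(embedding_nbhs he)[V xV VU].
apply: (@filterS _ F _ (u @^-1` (e @^-1` V))); last exact: eu.
by move=> i; exact: VU.
Qed.

Lemma embedding_within (S T W : topologicalType) (e : S -> T) (f : S -> W)
    (g : T -> W) :
  embedding e -> continuous f -> (forall x, g (e x) = f x) ->
  {within range e, continuous g}.
Proof.
move=> he cf gf; apply/subspace_continuousP => _ [x _ <-] U gU.
have /cf xU : nbhs (f x) U by rewrite -gf.
have [V exV VU] := embedding_nbhs he xU.
apply: filterS exV => z zV [y _ eyz]; move: zV; rewrite -eyz => /VU yU.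
by suff : U (g (e y)) by []; rewrite gf.
Qed.

Lemma embedding_comp (S T W : topologicalType) (e : S -> T) (f : T -> W) :
  embedding e -> embedding f -> embedding (f \o e).
Proof.
move=> [ie he] [jf hf]; split=> [x y /= /jf/ie//|U]; rewrite he; split.
  by move=> [V /hf[W' oW ->] ->]; exists W'.
by move=> [V oV ->]; exists (f @^-1` V) => //; apply/hf; exists V.
Qed.

Lemma set_val_embedding (T : topologicalType) (A : set T) :
  embedding (set_val : A -> T).
Proof.
by split=> [x y /val_inj//|U]; split=> [[V oV <-]|[V oV ->]]; exists V.
Qed.

Lemma range_set_val (T : Type) (A : set T) : range (set_val : A -> T) = A.
Proof.
apply/seteqP; split=> [_ [x _ <-]|x Ax]; first exact: set_valP.
by exists (exist _ x (mem_set Ax)).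
Qed.

Lemma embedding_closed (S T : topologicalType) (e : S -> T) (A : set S) :
  embedding e -> closed (range e) -> closed A -> closed (e @` A).
Proof.
move=> he ce cA y ye.
have [x _ exy] : range e y.
  apply: ce => U /ye[_ [[x Ax <-] Ux]]; exists (e x); split=> //.
exists x => //; apply: cA => U /(embedding_nbhs he)[V]; rewrite exy => /ye.
by move=> [_ [[z Az <-] Vz]] VU; exists z; split=> //; exact: VU.
Qed.

Lemma embeddingI (S T : topologicalType) (e : S -> T) :
  injective e -> continuous e ->
  (forall x U, nbhs x U -> exists2 V, nbhs (e x) V & e @^-1` V `<=` U) ->
  embedding e.
Proof.
move=> ie ce he; split=> // U.
split=> [oU|[V oV ->]]; last by move/continuousP: ce; exact.
(* The largest open set whose preimage under [e] lies in [U]. *)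
exists (interior (~` (e @` (~` U)))); first exact: open_interior.
apply/seteqP; split=> [x Ux|x /= /interior_subset xU]; last first.
  by apply: contrapT => nUx; apply: xU; exists x.
have /he[V xV VU] : nbhs x U by exact: open_nbhs_nbhs.
apply: filterS xV => _ /[swap] -[z nUz <-] /VU; exact: nUz.
Qed.

Lemma embedding_metric (R : realType) (S T : topologicalType)
    (d : S -> S -> R) (d' : T -> T -> R) (e : S -> T) :
  is_metric d -> is_metric d' ->
  (forall x y, d' (e x) (e y) = d x y) -> embedding e.
Proof.
move=> hd hd' de; have ie : injective e.
  by move=> x y exy; apply: (metric_eq0 hd); rewrite -de exy (metricxx hd').
have ce : continuous e.
  apply/(continuous_metricP _ hd hd') => x r r0; exists r => // y.
  by rewrite de.
apply: embeddingI => // x U /(nbhs_metricP hd)[r r0 rU].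
exists [set y | d' (e x) y < r]; first exact: near_metric.
by move=> y /=; rewrite de; exact: rU.
Qed.

Lemma embedding_prod (S T U : topologicalType) (e : S -> T) :
  embedding e -> embedding (fun p : S * U => (e p.1, p.2)).
Proof.
move=> he; apply: embeddingI => [[x s] [y t] /= [/he.1 -> ->]//||].
  apply: continuous_pair; last exact: continuous_snd.
  by apply: comp_continuous; [exact: continuous_fst|exact: embedding_continuous].
move=> [x s] V [[P Q] /= [/(embedding_nbhs he)[P' xP PP'] sQ] PQV].
exists (P' `*` Q); first by exists (P', Q).
by move=> [y t] /= [/PP' yP tQ]; exact: PQV.
Qed.

(** Moves a function on [S] to a total function on [T] with a default off the range, the form that
    the extension lemmas take. Continuity within the range is then supplied by
    [embedding_within]. *)
Lemma embedding_lift (S T W : Type) (e : S -> T) (f : S -> W) (g0 : T -> W) :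
  injective e -> exists g : T -> W, (forall x, g (e x) = f x) /\
    (forall y, ~ range e y -> g y = g0 y).
Proof.
move=> ie; exists (fun y =>
  if pselect (exists x, e x = y) is left h then f (projT1 (cid h)) else g0 y).
split=> [x|y ye]; case: pselect => [h|h] //.
- by congr f; apply: ie; exact: (projT2 (cid h)).
- by case: h; exists x.
by case: ye; case: h => x exy; exists x.
Qed.

(** * Z-embeddings into function cones *)

Lemma dist_max (R : realDomainType) (a b a' b' e : R) :
  `|a - a'| <= e -> `|b - b'| <= e ->
  `|Num.max a b - Num.max a' b'| <= e.
Proof.
rewrite !ler_distl => /andP[? ?] /andP[? ?].
by rewrite /Num.max; do 2!case: ifPn; rewrite -?leNgt => ? ?; apply/andP; split; lra.
Qed.

Definition in_cone (R : realType) (B : Type) (db : B -> B -> R)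
    (p : option B -> R) : Prop :=
  (forall i, 0 <= p i <= 1) /\
  (p None = 0 -> exists b, forall x, p (Some x) = db b x).

(* For a metric [db] bounded by 1, the points of height [p None = 0] are the
   distance functions [db b], so they form a copy of [B]; above it lies the
   whole function cube. *)
Definition cone (R : realType) (B : Type) (db : B -> B -> R) : Type :=
  {p : option B -> R | in_cone db p}.

Section ConeTopology.
Variables (R : realType) (B : Type) (db : B -> B -> R).
Implicit Types p q r : cone db.

Definition cone_dist p q : R := sup [set `|sval p i - sval q i| | i in setT].

Lemma cone_itv p i : 0 <= sval p i <= 1.
Proof. by case: p => p []. Qed.

Let has_sup_dist p q : has_sup [set `|sval p i - sval q i| | i in setT].
Proof.
split; first by exists `|sval p None - sval q None|; exists None.
exists 1 => _ [i _ <-]; have := cone_itv p i; have := cone_itv q i.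
by rewrite ler_distl; lra.
Qed.

Lemma cone_dist_ub p q i : `|sval p i - sval q i| <= cone_dist p q.
Proof. by apply: sup_upper_bound; [exact: has_sup_dist|exists i]. Qed.

Lemma cone_dist_le p q e :
  (forall i, `|sval p i - sval q i| <= e) -> cone_dist p q <= e.
Proof.
move=> h; apply: ge_sup; first by exists `|sval p None - sval q None|; exists None.
by move=> _ [i _ <-].
Qed.

Lemma cone_eq p q : sval p =1 sval q -> p = q.
Proof. by move=> /funext; exact: eq_sig_hprop. Qed.

Lemma cone_dist_eq0 p q : cone_dist p q = 0 <-> p = q.
Proof.
split=> [h|->].
  apply: cone_eq => i; have := cone_dist_ub p q i.
  by rewrite h normr_le0 subr_eq0 => /eqP.
apply/eqP; rewrite eq_le; apply/andP; split.
  by apply: cone_dist_le => i; rewrite subrr normr0.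
by have := cone_dist_ub q q None; rewrite subrr normr0.
Qed.

Lemma cone_distC p q : cone_dist p q = cone_dist q p.
Proof.
by apply/eqP; rewrite eq_le; apply/andP; split;
  apply: cone_dist_le => i; rewrite distrC; exact: cone_dist_ub.
Qed.

Lemma cone_dist_tri p q r : cone_dist p r <= cone_dist p q + cone_dist q r.
Proof.
apply: cone_dist_le => i; apply: le_trans (ler_distD (sval q i) _ _) _.
by apply: lerD; exact: cone_dist_ub.
Qed.

Definition cone_nbhs p : set_system (cone db) :=
  filter_from [set e : R | 0 < e] (fun e => [set q | cone_dist p q < e]).

HB.instance Definition _ := gen_eqMixin (cone db).
HB.instance Definition _ := gen_choiceMixin (cone db).
HB.instance Definition _ := hasNbhs.Build (cone db) cone_nbhs.

Let cone_nbhs_filter p : ProperFilter (nbhs p).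
Proof.
apply: filter_from_proper; last first.
  by move=> e e0; exists p; rewrite /= (cone_dist_eq0 p p).2.
apply: filter_from_filter; first by exists 1 => /=.
move=> e f /= e0 f0; exists (Num.min e f); first by rewrite /= lt_min e0.
by move=> q /=; rewrite lt_min => /andP.
Qed.

Let cone_nbhs_singleton p (A : set (cone db)) : nbhs p A -> A p.
Proof. by move=> [e /= e0]; apply; rewrite /= (cone_dist_eq0 p p).2. Qed.

Let cone_nbhs_nbhs p (A : set (cone db)) : nbhs p A -> nbhs p (nbhs^~ A).
Proof.
move=> [e /= e0 eA]; exists e => // q /= pq.
exists (e - cone_dist p q) => [|r /= qr]; first by rewrite /= subr_gt0.
by apply: eA => /=; have := cone_dist_tri p q r; lra.
Qed.

HB.instance Definition _ := Nbhs_isNbhsTopological.Build (cone db)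
  cone_nbhs_filter cone_nbhs_singleton cone_nbhs_nbhs.

Lemma cone_metric : is_metric cone_dist.
Proof.
split=> [p q|p q|p q r|p U]; first exact: cone_dist_eq0.
- exact: cone_distC.
- exact: cone_dist_tri.
by split=> -[e e0 eU]; exists e.
Qed.

(** Hausdorff's formula extends all coordinates at once, but its values may violate the condition at
    height 0. Taking the maximum of the height with the gap to [C] changes nothing on [C] and makes
    the height positive elsewhere, where the condition becomes vacuous. *)
Lemma cone_extension (Z : topologicalType) (C : set Z) (f : Z -> cone db) :
  metrizable R Z -> closed C -> {within C, continuous f} ->
  exists F : Z -> cone db,
    [/\ continuous F, forall z, C z -> F z = f z
      & forall z, ~ C z -> 0 < sval (F z) None].
Proof.
move=> [d hd0] cC; have hd : is_metric d := hd0.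
move=> /(within_metricP _ _ hd cone_metric) cf.
have [||G [G01 Gf cG]] := hausdorff_extension hd cC (g := fun z => sval (f z)).
- by move=> z i; exact: cone_itv.
- move=> z e Cz e0; have [r r0 hr] := cf z e Cz e0; exists r => // c Cc hc i.
  by apply/ltW; apply: le_lt_trans (hr c Cc hc); exact: cone_dist_ub.
pose g z i := if i is Some _ then G z i else Num.max (G z None) (gap d C z).
have gG z : C z -> g z = sval (f z).
  move=> Cz; rewrite -Gf//; apply/funext => -[b|]//=.
  by rewrite (gap0 hd)// max_l//; case/andP: (G01 z None).
have g_gt0 z : ~ C z -> 0 < g z None.
  by move=> nCz; rewrite lt_max (gap_gt0 hd)// orbT.
have gP z : in_cone db (g z).
  split=> [[b|]//=|g0].
    have /andP[? ?] := G01 z None; rewrite le_max ge_max.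
    by apply/andP; split; apply/andP || apply/orP; [left|split => //; exact: gap_le1].
  have [Cz|/g_gt0] := pselect (C z); last by rewrite g0 ltxx.
  by move: g0; rewrite gG//; case: (f z) => p [].
exists (fun z => exist _ (g z) (gP z)); split=> [|z Cz|]//; last first.
  by apply: cone_eq => i /=; rewrite gG.
apply/(continuous_metricP _ hd cone_metric) => z e e0.
(* The supremum over the coordinates preserves only weak inequalities, hence the bound [e / 2]. *)
have [r r0 hr] := cG z (e / 2) (divr_gt0 e0 (ltr0n _ 2)).
exists (Num.min r (e / 2)) => [|y]; first by rewrite lt_min r0 divr_gt0.
rewrite lt_min => /andP[/hr {}hr ye].
suff : forall i, `|g z i - g y i| <= e / 2.
  by move=> /(cone_dist_le (p := exist _ _ (gP z)) (q := exist _ _ (gP y))); lra.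
move=> [b|] /=; [exact: hr|apply: dist_max; first exact: hr].
have := gap_lip hd C z y; have := gap_lip hd C y z; rewrite (metricC hd y z).
by rewrite ler_distl => ? ?; apply/andP; split; lra.
Qed.

Lemma cone_const_subproof : in_cone db (fun=> 1).
Proof. by split=> [_|/eqP]; rewrite ?lexx ?ler01// oner_eq0. Qed.

(** A retraction is an extension of the inverse of the embedding, defined on its closed range. *)
Lemma cone_AR : absolute_retract R (cone db).
Proof.
split=> [|Z e mZ he cZ]; first by exists cone_dist; exact: cone_metric.
pose p0 : cone db := exist _ _ cone_const_subproof.
(* [f] inverts [e] on its range; [p0], a point of height 1, is the default elsewhere. *)
have [f [fe _]] := embedding_lift id (fun=> p0) he.1.
have [F [cF Ff _]] := cone_extension mZ cZ
  (embedding_within he (fun x => @cvg_id _ _) fe).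
by exists F => // p; rewrite Ff//; exists p.
Qed.

End ConeTopology.

Section ConeBase.
Variables (R : realType) (B : topologicalType) (db : B -> B -> R).
Hypotheses (hb : is_metric db) (db1 : forall x y, db x y <= 1).

Let base_fun (b : B) (i : option B) : R := if i is Some x then db b x else 0.

Let base_subproof b : in_cone db (base_fun b).
Proof.
split=> [[x|] /=|_]; [|by rewrite lexx ler01|by exists b].
by rewrite db1 (metric_ge0 hb).
Qed.

Definition cone_base (b : B) : cone db := exist _ _ (base_subproof b).

(** Kuratowski's isometry: the triangle inequality bounds every coordinate, and the coordinate
    [Some y] attains the bound. *)
Lemma cone_base_dist x y : cone_dist (cone_base x) (cone_base y) = db x y.
Proof.
apply/eqP; rewrite eq_le; apply/andP; split.
  apply: cone_dist_le => -[z|] /=; last first.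
    by rewrite subrr normr0 (metric_ge0 hb).
  have := metric_tri hb x y z; have := metric_tri hb y x z.
  by rewrite ler_distl (metricC hb y x) => ? ?; apply/andP; split; lra.
have := cone_dist_ub (cone_base x) (cone_base y) (Some y).
rewrite /= (metricxx hb) subr0; apply: le_trans; exact: ler_norm.
Qed.

Lemma cone_base_embedding : embedding cone_base.
Proof. exact: (embedding_metric hb (@cone_metric _ _ db) cone_base_dist). Qed.

Lemma range_cone_base : range cone_base = [set p | sval p None = 0].
Proof.
apply/seteqP; split=> [_ [b _ <-]//|p /= p0].
case: (svalP p) => _ /(_ p0)[b pb]; exists b => //.
by apply: cone_eq => -[x|] /=.
Qed.

Lemma cone_base_closed : closed (range cone_base).
Proof.
rewrite range_cone_base => p pc /=; apply/eqP/negPn/negP => p0.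
have pgt0 : 0 < sval p None.
  by rewrite lt_neqAle eq_sym p0; case/andP: (cone_itv p None).
have [q [/= q0]] := pc _ (near_metric (@cone_metric _ _ db) p pgt0).
have := cone_dist_ub p q None; rewrite q0 subr0 ger0_norm ?(ltW pgt0)//.
lra.
Qed.

Let push_fun (pt : cone db * unit_interval R) (i : option B) : R :=
  if i is None then Num.max (sval pt.1 None) (set_val pt.2) else sval pt.1 i.

Lemma interval_itv (t : unit_interval R) : 0 <= set_val t <= 1.
Proof. by have := set_valP t; rewrite /= in_itv. Qed.

Let push_subproof pt : in_cone db (push_fun pt).
Proof.
have /andP[t0 t1] := interval_itv pt.2.
split=> [i|/= h].
  have /andP[p0 p1] := cone_itv pt.1 i; case: i p0 p1 => [x|] /= p0 p1.
    by rewrite p0 p1.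
  by rewrite le_max p0 ge_max p1 t1.
have /andP[p0 _] := cone_itv pt.1 None.
case: (svalP pt.1) => _; apply; move: h; rewrite /Num.max; case: ifPn => //.
by move=> /[swap] ->; rewrite ltNge p0.
Qed.

(** The homotopy replaces the height by its maximum with [t] and fixes the other coordinates. The
    new height is 0 only if the old one was, so the condition at height 0 is inherited. *)
Lemma cone_base_negligible : homotopy_negligible R (range cone_base).
Proof.
exists (fun pt => exist _ _ (push_subproof pt)); split.
- have hI := metric_sub (`[0, 1]%classic : set R) (real_metric R).
  apply/(continuous_metricP _ (metric_prod (@cone_metric _ _ db) hI)
    (@cone_metric _ _ db)) => -[p t] e e0.
  exists (e / 2) => [|[q s] /=]; first by rewrite divr_gt0.
  rewrite gt_max => /andP[pq ts]; apply: (@le_lt_trans _ _ (e / 2)); last by lra.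
  apply: cone_dist_le => -[x|] /=.
    by apply: le_trans (ltW pq); exact: cone_dist_ub.
  apply: dist_max; last exact: ltW.
  by apply: le_trans (ltW pq); exact: cone_dist_ub.
- move=> p; apply: cone_eq => -[x|] //=.
  by rewrite max_l//; case/andP: (cone_itv p None).
move=> p t t0; rewrite range_cone_base /= => h.
have tm : set_val t <= Num.max (sval p None) (set_val t).
  by rewrite le_max lexx orbT.
by have := lt_le_trans t0 tm; rewrite h ltxx.
Qed.

End ConeBase.

(** * The unit interval and its operations *)

Section UnitInterval.
Variable R : realType.
Implicit Types s t : unit_interval R.

Lemma clamp_subproof (x : R) :
  Num.max 0 (Num.min 1 x) \in (`[0, 1]%classic : set R).
Proof.
by rewrite inE /= in_itv /= le_max lexx ge_max ler01 ge_min lexx.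
Qed.

(** The retraction of the line onto the interval. It turns any real formula into a time; [clampE]
    recovers the value when it is in range. *)
Definition clamp (x : R) : unit_interval R := 
  exist _ (Num.max 0 (Num.min 1 x)) (clamp_subproof x).

Lemma clampE x : 0 <= x <= 1 -> set_val (clamp x) = x.
Proof. by move=> /andP[? ?]; rewrite /= /set_val/= min_r// max_r. Qed.

Lemma clampK t : clamp (set_val t) = t.
Proof. by apply: val_inj; exact/clampE/interval_itv. Qed.

Lemma clamp0 : clamp 0 = I0 R.
Proof. by apply: val_inj; apply: clampE; rewrite lexx ler01. Qed.

Lemma clamp1 : clamp 1 = I1 R.
Proof. by apply: val_inj; apply: clampE; rewrite lexx ler01. Qed.

Lemma set_val_I0 : set_val (I0 R) = 0. Proof. by []. Qed.
Lemma set_val_I1 : set_val (I1 R) = 1. Proof. by []. Qed.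

Lemma interval_metric :
  is_metric (fun s t : unit_interval R => `|set_val s - set_val t|).
Proof. exact: (metric_sub _ (real_metric R)). Qed.

Lemma clamp_continuous : continuous clamp.
Proof.
apply/(continuous_metricP _ (real_metric R) interval_metric) => x e e0.
exists e => // y; rewrite -[set_val (clamp x)]/(Num.max 0 (Num.min 1 x)).
rewrite -[set_val (clamp y)]/(Num.max 0 (Num.min 1 y)).
rewrite !ltr_distl /Num.max /Num.min => /andP[? ?].
by do !case: ifPn; rewrite -?leNgt => *; apply/andP; split; lra.
Qed.

Lemma interval_eq0 t : ~ 0 < set_val t -> t = I0 R.
Proof.
move=> t0; have /andP[t1 t2] := interval_itv t.
by apply: val_inj; rewrite -[LHS]/(set_val t) -[RHS]/(0 : R); move: t0 t1; case: ltgtP.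
Qed.

Definition interval_mul s t : unit_interval R := clamp (set_val s * set_val t).

Lemma interval_mulE s t : set_val (interval_mul s t) = set_val s * set_val t.
Proof.
apply: clampE; have /andP[s0 s1] := interval_itv s.
by have /andP[t0 t1] := interval_itv t; rewrite mulr_ge0//= mulr_ile1.
Qed.

Lemma interval_mul_continuous :
  continuous (fun st : unit_interval R * unit_interval R =>
    interval_mul st.1 st.2).
Proof.
apply/(continuous_metricP _ (metric_prod interval_metric interval_metric)
  interval_metric) => -[s t] e e0; exists (e / 2) => [|[s' t'] /=].
  by rewrite divr_gt0.
rewrite gt_max !interval_mulE => /andP[hs ht].
have /andP[s0 s1] := interval_itv s; have /andP[t0 t1] := interval_itv t'.
have -> : set_val s * set_val t - set_val s' * set_val t' =
  set_val s * (set_val t - set_val t') + (set_val s - set_val s') * set_val t'.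
  by ring.
apply: le_lt_trans (ler_normD _ _) _; rewrite !normrM.
rewrite (ger0_norm s0) (ger0_norm t0).
have : set_val s * `|set_val t - set_val t'| <= `|set_val t - set_val t'|.
  by rewrite ler_piMl.
have : `|set_val s - set_val s'| * set_val t' <= `|set_val s - set_val s'|.
  by rewrite ler_piMr.
lra.
Qed.

Definition interval_rev t : unit_interval R := clamp (1 - set_val t).

Lemma interval_rev_continuous : continuous interval_rev.
Proof.
apply/(continuous_metricP _ interval_metric interval_metric) => x e e0.
exists e => // y; rewrite /interval_rev !clampE.
- by rewrite distrC; congr (`|_| < _); ring.
- by have /andP[? ?] := interval_itv y; apply/andP; split; lra.
by have /andP[? ?] := interval_itv x; apply/andP; split; lra.
Qed.

Lemma interval_compact : compact [set: unit_interval R].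
Proof.
have -> : [set: unit_interval R] = clamp @` `[0, 1]%classic.
  apply/seteqP; split=> // t _; exists (set_val t); last exact: clampK.
  exact: set_valP.
apply: continuous_compact; last exact: segment_compact.
by apply: continuous_subspaceT; exact: clamp_continuous.
Qed.

Lemma height_continuous (T : topologicalType) :
  continuous (fun xt : T * unit_interval R => set_val xt.2 : R).
Proof.
move=> xt; apply: (@continuous_comp _ _ _ snd set_val); first exact: cvg_snd.
exact: set_val_continuous.
Qed.

Lemma closed_level (T : topologicalType) (r : R) :
  closed [set xt : T * unit_interval R | set_val xt.2 = r].
Proof. exact: (closed_preimage (@height_continuous T) (@closed_eq R r)). Qed.

End UnitInterval.

(** * Cluster points of sequences *)

Section Sequences.

Lemma cluster_cvg (T : topologicalType) (u : nat -> T)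
    (x : T) :
  u @ \oo --> x -> cluster (u @ \oo) x.
Proof. by move=> ux A B Au /ux Bu; apply: filter_ex (filterI Au Bu). Qed.

Lemma cluster_comp (S T : topologicalType) (f : S -> T) (u : nat -> S) x :
  {for x, continuous f} -> cluster (u @ \oo) x ->
  cluster (f \o u @ \oo) (f x).
Proof.
move=> cf ux A B uA /cf xB.
by have [y []] := ux (f @^-1` A) (f @^-1` B) uA xB; exists (f y).
Qed.

(** One sequence has to converge: two merely clustering sequences may do so along disjoint sets of
    indices. Convergence of [v] allows the test of [u] to be restricted to indices where [v] is
    already close to [y]. *)
Lemma cluster_cvg_pair (S T : topologicalType) (u : nat -> S) (v : nat -> T)
    x y :
  cluster (u @ \oo) x -> v @ \oo --> y ->
  cluster ((fun n => (u n, v n)) @ \oo) (x, y).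
Proof.
move=> ux vy A B uvA [[/= P Q] [/= xP /vy yQ] PQB].
have uA : (u @ \oo) (u @` [set n | A (u n, v n) /\ Q (v n)]).
  apply: (@filterS _ \oo _ [set n | A (u n, v n) /\ Q (v n)]).
    by move=> n ?; exists n.
  exact: (@filterI _ \oo _ (fun n => A (u n, v n)) (Q \o v) uvA yQ).
have [_ [[n [nA nQ] <-] Pn]] := ux _ P uA xP.
by exists (u n, v n); split=> //; apply: PQB.
Qed.

(** The condition [n <= phi n] sends each tail into the corresponding tail. Such reindexings can be
    obtained from [choice], one index at a time. *)
Lemma cluster_subseq (T : topologicalType) (u : nat -> T) (phi : nat -> nat)
    (x : T) :
  (forall n, n <= phi n)%N -> cluster (u \o phi @ \oo) x ->
  cluster (u @ \oo) x.
Proof.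
move=> hphi ux A B [N _ NA] xB; apply: ux xB; exists N => // n /= Nn.
by apply: NA => /=; exact: leq_trans (hphi n).
Qed.

Lemma cvg_subseq (T : topologicalType) (u : nat -> T) (phi : nat -> nat)
    (x : T) :
  (forall n, n <= phi n)%N -> u @ \oo --> x -> u \o phi @ \oo --> x.
Proof.
move=> hphi ux U /ux[N _ NU]; exists N => // n /= Nn.
by apply: NU => /=; exact: leq_trans (hphi n).
Qed.

Lemma cluster_cvg_subseq (R : realType) (T : topologicalType) (u : nat -> T)
    (x : T) :
  metrizable R T -> cluster (u @ \oo) x ->
  exists2 phi : nat -> nat, (forall n, n <= phi n)%N & u \o phi @ \oo --> x.
Proof.
move=> [d hd0] ux; have hd : is_metric d := hd0.
have /choice[phi hphi] : forall n : nat, exists m : nat,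
    (n <= m)%N /\ d x (u m) < n.+1%:R^-1.
  move=> n; have [||_ [[m /= nm <-] dm]] :=
    ux (u @` [set m | n <= m]%N) [set y | d x y < n.+1%:R^-1].
  - by exists n => // m nm; exists m.
  - by apply: near_metric => //; rewrite invr_gt0.
  - by exists m.
exists phi => [n|]; first by have [] := hphi n.
apply/(cvg_metricP hd) => e e0; have [N _ hN] := near_infty_natSinv_lt (PosNum e0).
by exists N => // n /hN /=; apply: lt_trans; have [] := hphi n.
Qed.

Lemma cvg_dist (R : realType) (T : topologicalType) (d : T -> T -> R)
    (u v : nat -> T) (r : nat -> R) (x : T) :
  is_metric d -> u @ \oo --> x -> r @ \oo --> (0 : R) ->
  (forall n, d (u n) (v n) <= r n) -> v @ \oo --> x.
Proof.
move=> hd /(cvg_metricP hd) ux /(cvg_metricP (real_metric R)) r0 uv.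
apply/(cvg_metricP hd) => e e0; have e20 : 0 < e / 2 by rewrite divr_gt0.
apply: filterS (filterI (ux _ e20) (r0 _ e20)) => n /= [un].
rewrite sub0r normrN => rn.
have := metric_tri hd x (u n) (v n); have := uv n; have := ler_norm (r n); lra.
Qed.

Lemma cluster_dist (R : realType) (T : topologicalType) (d : T -> T -> R)
    (u v : nat -> T) (r : nat -> R) (x : T) :
  is_metric d -> cluster (u @ \oo) x -> r @ \oo --> (0 : R) ->
  (forall n, d (u n) (v n) <= r n) -> cluster (v @ \oo) x.
Proof.
move=> hd ux r0 uv; have mT : metrizable R T by exists d.
have [phi hphi uphi] := cluster_cvg_subseq mT ux.
apply: (cluster_subseq hphi); apply: cluster_cvg.
by apply: (cvg_dist hd uphi (cvg_subseq hphi r0)) => n; exact: uv.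
Qed.

End Sequences.

(** * Absolute retracts are absolute extensors *)

Section Extension.
Variables (R : realType) (B Z : topologicalType) (C : set Z) (f : Z -> B).
Hypotheses (arB : absolute_retract R B) (mZ : metrizable R Z).
Hypotheses (cC : closed C) (cf : {within C, continuous f}).

(** [B] is a closed subset of its own cone, hence a retract of it: extend into the cone and retract.
    The metric is first truncated at 1, as the coordinates of the cone lie in the unit interval. *)
Lemma AR_extension :
  exists2 F : Z -> B, continuous F & forall z, C z -> F z = f z.
Proof.
have [[d hd] retr] := arB.
have hb := bounded_metric hd; set db := (fun x y => _) in hb.
have db1 x y : db x y <= 1 by rewrite ge_min lexx.
have mc : metrizable R (cone db) by eexists; exact: cone_metric.
have he := cone_base_embedding hb db1.
have [r cr rK] := retr _ _ mc he (@cone_base_closed _ _ _ hb db1).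
have [|F [cF Ff _]] := @cone_extension R B db Z C (cone_base hb db1 \o f) mZ cC.
  by apply: within_continuous_comp cf => b _; exact: embedding_continuous.
exists (r \o F) => [|z Cz]; first exact: comp_continuous.
by rewrite /= Ff//= rK.
Qed.

(** An extension is followed by the homotopy of [B] off [Y], run for the time [gap d C z], which is
    0 on [C] and positive off it. *)
Lemma push_extension (Y : set B) : homotopy_negligible R Y ->
  exists F : Z -> B,
    [/\ continuous F, forall z, C z -> F z = f z
      & forall z, ~ C z -> ~ Y (F z)].
Proof.
move=> [h [ch h0 hY]]; have [F cF Ff] := AR_extension.
case: mZ => d hd.
exists (fun z => h (F z, clamp (gap d C z))); split=> [|z Cz|z nCz].
- apply: (comp_continuous _ ch); apply: continuous_pair => //.
  by apply: comp_continuous; [exact: gap_continuous|exact: clamp_continuous].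
- by rewrite (gap0 hd)// clamp0 h0 Ff.
apply: hY; rewrite clampE ?(gap_gt0 hd)//.
by rewrite (gap_ge0 hd) (gap_le1 hd).
Qed.

End Extension.

Lemma continuous_addr (R : realType) (T : topologicalType) (f g : T -> R) :
  continuous f -> continuous g -> continuous (fun x => f x + g x).
Proof.
move=> cf cg x; apply/(cvg_metricP (real_metric R)) => e e0.
have e20 : 0 < e / 2 by rewrite divr_gt0.
have /(cvg_metricP (real_metric R))/(_ _ e20) fx := cf x.
have /(cvg_metricP (real_metric R))/(_ _ e20) gx := cg x.
apply: filterS (filterI fx gx) => y [/=]; rewrite !ltr_distl.
by move=> /andP[? ?] /andP[? ?]; apply/andP; split; lra.
Qed.

(** * Functions vanishing exactly on a closed set, at a controlled rate *)

Section VanishingFunction.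

Lemma sup_dist (R : realType) (a b : nat -> R) (e : R) :
  (forall n, 0 <= a n <= 1) -> (forall n, 0 <= b n <= 1) ->
  (forall n, `|a n - b n| <= e) ->
  `|sup (range a) - sup (range b)| <= e.
Proof.
move=> a01 b01 ab.
have bnd (c : nat -> R) : (forall n, 0 <= c n <= 1) -> has_sup (range c).
  move=> c01; split; first by exists (c 0%N); exists 0%N.
  by exists 1 => _ [n _ <-]; case/andP: (c01 n).
have half (c c' : nat -> R) : (forall n, 0 <= c' n <= 1) ->
    (forall n, `|c n - c' n| <= e) -> sup (range c) <= sup (range c') + e.
  move=> c01 cc; apply: ge_sup; first by exists (c 0%N); exists 0%N.
  move=> _ [n _ <-]; have := cc n; rewrite ler_distl => /andP[_ h].
  apply: le_trans h _; rewrite lerD2r; apply: sup_upper_bound; first exact: bnd.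
  by exists n.
rewrite ler_distl lerBlDr !half//= => n; by rewrite distrC.
Qed.

(** [tau] is the supremum of [v n / n], with [v n] a Urysohn function that is 0 on [X] and 1 off the
    interior of [G n]. If [k.+1] is the first index with [z] outside the interior of [G k.+1], then
    [z] is in [G k] and the term of index [k.+1] gives [tau z] at least [k.+1%:R^-1]. Thus what
    [G k] controls at times from [k.+1%:R^-1] on holds at time [tau z]. *)
Lemma vanishing_function (R : realType) (T : topologicalType) (X : set T)
    (G : nat -> set T) :
  metrizable R T -> closed X -> (forall n x, X x -> nbhs x (G n)) ->
  exists tau : T -> unit_interval R,
    [/\ continuous tau, forall x, X x -> tau x = I0 R,
        forall z, ~ X z -> 0 < set_val (tau z)
      & forall x, X x -> \forall z \near x, ~ X z ->
          exists2 k, G k z & k.+1%:R^-1 <= set_val (tau z)].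
Proof.
move=> [d hd0] cX XG; have hd : is_metric d := hd0.
pose C n := ~` (interior (G n)).
have cC n : closed (C n) by apply: open_closedC; exact: open_interior.
(* The closed sets [X] and [C n] are disjoint, so the two gaps never vanish together. *)
have den_gt0 n z : 0 < gap d X z + gap d (C n) z.
  have [Xz|nXz] := pselect (X z); last by rewrite ltr_wpDr ?gap_ge0 ?gap_gt0.
  by rewrite ltr_wpDl ?gap_ge0// gap_gt0// => /(_ (XG n z Xz)).
pose v n z := gap d X z / (gap d X z + gap d (C n) z).
have v01 n z : 0 <= v n z <= 1.
  rewrite divr_ge0 ?gap_ge0 ?(ltW (den_gt0 n z))//=.
  by rewrite ler_pdivrMr// mul1r lerDl gap_ge0.
have cden n : continuous (fun z => gap d X z + gap d (C n) z).
  by apply: continuous_addr; exact: gap_continuous.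
have cv n : continuous (v n).
  move=> z; apply: cvgM; first exact: gap_continuous.
  apply: cvgV; first by rewrite gt_eqF.
  exact: cden.
(* The term n = 0 vanishes, as 0%:R^-1 = 0. *)
pose a z n := v n z * n%:R^-1.
have n01 n : 0 <= (n%:R^-1 : R) <= 1.
  case: n => [|n]; rewrite ?invr0 ?lexx ?ler01//.
  by rewrite invr_ge0 ler0n invf_le1 ?ltr0n// ler1n.
have a01 z n : 0 <= a z n <= 1.
  have /andP[? ?] := v01 n z; have /andP[? ?] := n01 n.
  by rewrite mulr_ge0//= mulr_ile1.
have a_le z n : a z n <= sup (range (a z)).
  apply: sup_upper_bound; last by exists n.
  split; first by exists (a z 0%N); exists 0%N.
  by exists 1 => _ [m _ <-]; case/andP: (a01 z m).
have s01 z : 0 <= sup (range (a z)) <= 1.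
  rewrite (le_trans _ (a_le z 0%N)); last by case/andP: (a01 z 0%N).
  apply: ge_sup; first by exists (a z 0%N); exists 0%N.
  by move=> _ [m _ <-]; case/andP: (a01 z m).
have csup : continuous (fun z => sup (range (a z))).
  move=> z; apply/(cvg_metricP (real_metric R)) => e e0.
  have e20 : 0 < e / 2 by rewrite divr_gt0.
  (* Terms of index above [N] lie between 0 and [e / 2] at every point; the finitely many others are
     controlled together by continuity at [z]. *)
  have [N _ hN] := near_infty_natSinv_lt (PosNum e20).
  have : \forall y \near z, forall n : 'I_N.+1, `|v n z - v n y| < e / 2.
    apply: filter_forall => n.
    exact: (cvg_metricP (real_metric R) _ _ _).1 (cv n z) _ e20.
  apply: filterS => y vy; apply: (@le_lt_trans _ _ (e / 2)); last by lra.
  apply: sup_dist => // n; have [nN|Nn] := ltnP n N.+1.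
    rewrite -mulrBl normrM; apply: le_trans (ltW (vy (Ordinal nN))).
    by have /andP[? ?] := n01 n; rewrite ler_piMr// ger0_norm.
  case: n Nn => // n Nn; have hn : n.+1%:R^-1 < e / 2 := hN n Nn.
  have /andP[? ?] := n01 n.+1.
  have aN w : 0 <= a w n.+1 <= e / 2.
    have /andP[? ?] := v01 n.+1 w; rewrite mulr_ge0//=.
    by apply: le_trans (ltW hn); rewrite ler_piMl.
  have /andP[? ?] := aN z; have /andP[? ?] := aN y.
  by rewrite ler_distl; apply/andP; split; lra.
have sup_gt0 z : ~ X z -> 0 < sup (range (a z)).
  move=> nXz; apply: lt_le_trans (a_le z 1%N).
  by rewrite /a invr1 mulr1 divr_gt0// gap_gt0.
exists (fun z => clamp (sup (range (a z)))); split.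
- by apply: comp_continuous csup _; exact: clamp_continuous.
- move=> x Xx; rewrite -(clamp0 R); congr clamp.
  have -> : range (a x) = [set 0].
    apply/seteqP; split=> [_ [n _ <-]|_ ->]; last first.
      by exists 0%N => //; rewrite /a invr0 mulr0.
    by rewrite /a /v (gap0 hd)// !mul0r.
  exact: sup1.
- by move=> z nXz; rewrite clampE// sup_gt0.
(* Starting inside the interior of [G 0] ensures that the first failing index, if any, is a
   successor. If none fails, any [N] with [N.+1%:R^-1] below the supremum will do. *)
move=> x Xx; apply: filterS (nbhs_interior (XG 0%N x Xx)) => z G0z nXz.
rewrite clampE//; have [Gz|/existsNP Gz] := pselect (forall k, interior (G k) z).
  have [N _ /(_ N (leqnn N)) hN] := near_infty_natSinv_lt (PosNum (sup_gt0 z nXz)).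
  by exists N; [exact: interior_subset (Gz N)|exact: ltW].
have exk : exists k, `[< ~ interior (G k) z >].
  by case: Gz => k hk; exists k; apply/asboolP.
have [k /asboolP hk mink] := ex_minnP exk.
case: k hk mink => // k hk mink; exists k.
  apply: contrapT => nGk; have /mink : `[< ~ interior (G k) z >].
    by apply/asboolP => /interior_subset.
  by rewrite ltnn.
(* [z] lies in [C k.+1], whose gap therefore vanishes at [z], so [v k.+1 z] is 1. *)
apply: le_trans (a_le z k.+1); rewrite /a /v (gap0 hd (C := C k.+1))//.
by rewrite addr0 divff ?mul1r// gt_eqF// gap_gt0.
Qed.

End VanishingFunction.

(** * Approaching homotopies *)

Section ApproachingTools.
Variables (R : realType).

(** In the metrizable product with the interval, a cluster point is the limit of a reindexed
    sequence, and a cluster point of the reindexed images is one of the images. *)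
Lemma approaching_homotopyI (M N : topologicalType) (X : set M) (Y : set N)
    (H : (~` X * unit_interval R)%type -> ~` Y) :
  metrizable R M -> continuous H ->
  (forall (u : nat -> ~` X) (s : nat -> unit_interval R) (x : M)
      (t : unit_interval R), X x ->
    set_val \o u @ \oo --> x -> s @ \oo --> t ->
    clusters_in Y (fun n => set_val (H (u n, s n)))) ->
  approaching_homotopy H.
Proof.
move=> mM cH h; split=> // us [[x t] [/= Xx _]].
move=> /(cluster_cvg_subseq (metrizable_prod mM (metrizable_interval R))).
move=> [phi hphi uxt].
have [||y Yy fy] := h (fun n => (us (phi n)).1) (fun n => (us (phi n)).2) x t Xx.
- exact: (cvg_comp _ _ uxt (@continuous_fst _ _ (x, t))).
- exact: (cvg_comp _ _ uxt (@continuous_snd _ _ (x, t))).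
exists y => //; apply: (cluster_subseq hphi).
by move: fy; congr (cluster (_ @ \oo) y); apply/funext => n /=; case: (us _).
Qed.

Lemma approaching_of_continuous (M N : topologicalType) (X : set M)
    (Y : set N) (f : ~` X -> ~` Y) (g : M -> N) :
  continuous g -> (forall p, g (set_val p) = set_val (f p)) ->
  (forall x, X x -> Y (g x)) -> approaching f.
Proof.
move=> cg gf gX; have gfE : set_val \o f = g \o set_val by apply/funext => p /=.
split=> [|u [x Xx ux]].
  apply: continuous_set_type; rewrite gfE.
  by apply: comp_continuous cg; exact: set_val_continuous.
by exists (g x); [exact: gX|rewrite gfE; exact: (cluster_comp (cg x) ux)].
Qed.

Lemma approaching_homotopy_of_continuous (M N : topologicalType) (X : set M)
    (Y : set N) (H : (~` X * unit_interval R)%type -> ~` Y)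
    (K : (M * unit_interval R)%type -> N) :
  continuous K -> (forall p s, K (set_val p, s) = set_val (H (p, s))) ->
  (forall x s, X x -> Y (K (x, s))) -> approaching_homotopy H.
Proof.
move=> cK KH KX.
have KHE : set_val \o H = K \o (fun ps => (set_val ps.1, ps.2)).
  by apply/funext => -[p s] /=.
split=> [|u [[x s] [/= Xx _] us]].
  apply: continuous_set_type; rewrite KHE; apply: comp_continuous cK.
  apply: continuous_pair; last exact: continuous_snd.
  by apply: comp_continuous; [exact: continuous_fst|exact: set_val_continuous].
exists (K (x, s)); first exact: KX.
by rewrite KHE; exact: (cluster_comp (cK (x, s)) us).
Qed.

Variables (M N : topologicalType) (X : set M) (Y : set N).
Implicit Types f g : ~` X -> ~` Y.

Lemma approaching_homotopy_reparam
    (H : (~` X * unit_interval R)%type -> ~` Y)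
    (rho : unit_interval R -> unit_interval R) :
  approaching_homotopy H -> continuous rho ->
  approaching_homotopy (fun ps => H (ps.1, rho ps.2)).
Proof.
move=> [cH aH] cr; split=> [|u [[x s] [/= Xx _] us]].
  apply: comp_continuous cH; apply: continuous_pair; first exact: continuous_fst.
  by apply: comp_continuous cr; exact: continuous_snd.
apply: (aH (fun n => ((u n).1, rho (u n).2))); exists (x, rho s) => //.
have cf : continuous (fun xs : M * unit_interval R => (xs.1, rho xs.2)).
  apply: continuous_pair; first exact: continuous_fst.
  by apply: comp_continuous cr; exact: continuous_snd.
exact: (cluster_comp (cf (x, s)) us).
Qed.

Lemma approaching_cst_homotopy f :
  approaching f -> approaching_homotopy (R := R) (fun ps => f ps.1).
Proof.
move=> [cf af]; split=> [|u [[x s] [/= Xx _] us]].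
  by apply: comp_continuous cf; exact: continuous_fst.
apply: (af (fst \o u)); exists x => //.
exact: (cluster_comp (@continuous_fst _ _ (x, s)) us).
Qed.

Lemma approaching_homotopic_refl f : approaching f -> approaching_homotopic R f f.
Proof.
move=> af; exists (fun ps => f ps.1); split=> //.
exact: approaching_cst_homotopy.
Qed.

Lemma approaching_slice (H : (~` X * unit_interval R)%type -> ~` Y) s :
  approaching_homotopy H -> approaching (fun p => H (p, s)).
Proof.
move=> [cH aH]; split=> [|u [x Xx ux]].
  apply: (comp_continuous _ cH); apply: continuous_pair; last exact: cst_continuous.
  by move=> p; exact: cvg_id.
apply: (aH (fun n => (u n, s))); exists (x, s) => //.
by apply: cluster_cvg_pair ux _; exact: cvg_cst.
Qed.

Lemma approaching_homotopic_sym f g :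
  approaching_homotopic R f g -> approaching_homotopic R g f.
Proof.
move=> [H [aH H0 H1]]; exists (fun ps => H (ps.1, interval_rev ps.2)); split=> [|p|p].
- exact: (approaching_homotopy_reparam aH (@interval_rev_continuous R)).
- by rewrite /interval_rev /= set_val_I0 subr0 clamp1.
- by rewrite /interval_rev /= set_val_I1 subrr clamp0.
Qed.

Lemma approaching_homotopic_trans g f k : metrizable R M ->
  approaching_homotopic R f g -> approaching_homotopic R g k ->
  approaching_homotopic R f k.
Proof.
move=> mM [H [aH H0 H1]] [K [aK K0 K1]].
pose r1 (s : unit_interval R) := clamp (set_val s + set_val s).
pose r2 (s : unit_interval R) := clamp (set_val s + set_val s - 1).
have cval : continuous (set_val : unit_interval R -> R) by exact: set_val_continuous.
have c2 := continuous_addr cval cval.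
have cr1 : continuous r1 by exact: (comp_continuous c2 (@clamp_continuous R)).
have c2' := continuous_addr c2 (@cst_continuous _ _ (- 1 : R)).
have cr2 : continuous r2 by exact: (comp_continuous c2' (@clamp_continuous R)).
have [cH' aH'] := approaching_homotopy_reparam aH cr1.
have [cK' aK'] := approaching_homotopy_reparam aK cr2.
pose L ps := if set_val ps.2 <= 2^-1 :> R then H (ps.1, r1 ps.2) else K (ps.1, r2 ps.2).
have r1E (s : unit_interval R) : set_val s = 2^-1 :> R -> r1 s = I1 R.
  by move=> h; rewrite /r1 h (_ : 2^-1 + 2^-1 = 1) ?clamp1//; lra.
have r2E (s : unit_interval R) : set_val s = 2^-1 :> R -> r2 s = I0 R.
  by move=> h; rewrite /r2 h (_ : 2^-1 + 2^-1 - 1 = 0) ?clamp0//; lra.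
exists L; split=> [|p|p].
- apply: approaching_homotopyI => //.
    pose A1 : set (~` X * unit_interval R)%type := [set ps | set_val ps.2 <= 2^-1 :> R].
    pose A2 : set (~` X * unit_interval R)%type := [set ps | 2^-1 <= set_val ps.2 :> R].
    have cs : continuous (fun ps : (~` X * unit_interval R)%type => set_val ps.2 : R).
      by apply: comp_continuous cval; exact: continuous_snd.
    apply/continuous_subspace_setT.
    have -> : setT = A1 `|` A2.
      apply/seteqP; split=> // ps _; rewrite /A1 /A2 /=.
      by case: (leP (set_val ps.2) (2^-1 : R)) => h; [left|right; exact: ltW].
    apply: withinU_continuous.
    + exact: (closed_preimage cs (@closed_le R 2^-1)).
    + exact: (closed_preimage cs (@closed_ge R 2^-1)).
    + apply: (within_eq _ (continuous_subspaceT cH')) => -[p s].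
      by rewrite /A1 /L /= => ->.
    + apply: (within_eq _ (continuous_subspaceT cK')) => -[p s].
      rewrite /A2 /L /= => h; case: ifPn => // h'.
      have e : set_val s = 2^-1 :> R by apply/le_anti/andP.
      by rewrite r1E// r2E// H1 K0.
  move=> u s x t Xx ux st.
  (* The times may alternate between the two halves of the concatenation. Either arbitrarily late
     indices have times in the first half, or all late ones are in the second; a reindexing into
     that half sees only one of the two homotopies. *)
  have seq_in (P : nat -> Prop) (Q : (~` X * unit_interval R)%type -> ~` Y) :
      approaching_homotopy Q -> (forall n, P n -> L (u n, s n) = Q (u n, s n)) ->
      (forall n, exists m, (n <= m)%N /\ P m) ->
      clusters_in Y (fun n => set_val (L (u n, s n))).
    move=> [_ aQ] LQ /choice[phi hphi].
    have phin n : (n <= phi n)%N by have [] := hphi n.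
    have [|y Yy Qy] := aQ (fun n => (u (phi n), s (phi n))).
      exists (x, t) => //; apply: (cluster_cvg_pair _ (cvg_subseq phin st)).
      exact: (cluster_cvg (cvg_subseq phin ux)).
    exists y => //; apply: (cluster_subseq phin).
    move: Qy; congr (cluster (_ @ \oo) y); apply/funext => n /=.
    by rewrite LQ//; have [] := hphi n.
  have [h|/existsNP[m0 hN]] :=
      pselect (forall n, exists m, (n <= m)%N /\ set_val (s m) <= 2^-1 :> R).
    by apply: (seq_in _ _ (conj cH' aH') _ h) => n; rewrite /L /= => ->.
  apply: (seq_in (fun m => 2^-1 < set_val (s m) :> R) _ (conj cK' aK')) => [n|n].
    by rewrite /L /= leNgt => ->.
  exists (maxn n m0); split; first exact: leq_maxl.
  rewrite ltNge; apply/negP => h; apply: hN; exists (maxn n m0).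
  by split=> //; exact: leq_maxr.
- by rewrite /L /= set_val_I0 invr_ge0 ler0n /r1 set_val_I0 addr0 clamp0.
- rewrite /L /= set_val_I1 /r2 set_val_I1.
  rewrite ifF; last by apply/negP; lra.
  by rewrite (_ : 1 + 1 - 1 = 1) ?clamp1//; lra.
Qed.

End ApproachingTools.

Definition lift_off (T : Type) (X : set T) (x : T) (nX : ~ X x) : ~` X :=
  exist _ x (mem_set nX).

Lemma lift_map (S T : Type) (X : set T) (f : S -> T) :
  (forall s, ~ X (f s)) -> exists g : S -> ~` X, forall s, set_val (g s) = f s.
Proof. by move=> fX; exists (fun s => lift_off (fX s)). Qed.

Lemma approaching_homotopic_comp_l (R : realType) (M N L : topologicalType)
    (X : set M) (Y : set N) (Z : set L) (f g : ~` X -> ~` Y) (k : ~` Y -> ~` Z) :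
  approaching k -> approaching_homotopic R f g ->
  approaching_homotopic R (k \o f) (k \o g).
Proof.
move=> [ck ak] [H [[cH aH] H0 H1]]; exists (k \o H); split=> [|p|p] /=.
- split; first exact: comp_continuous.
  by move=> u /aH; exact: (ak (H \o u)).
- by rewrite H0.
- by rewrite H1.
Qed.

(** Metrizability of [M] is what makes the times convergent, and a cluster point of [k \o u] can
    then be paired with their limit. *)
Lemma approaching_homotopic_comp_r (R : realType) (M N L : topologicalType)
    (X : set M) (Y : set N) (Z : set L) (f g : ~` Y -> ~` Z) (k : ~` X -> ~` Y) :
  metrizable R M -> approaching k -> approaching_homotopic R f g ->
  approaching_homotopic R (f \o k) (g \o k).
Proof.
move=> mM [ck ak] [H [[cH aH] H0 H1]].
exists (fun ps => H (k ps.1, ps.2)); split=> [|p|p] //=.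
apply: approaching_homotopyI => // [|u s x t Xx ux st].
  apply: comp_continuous cH; apply: continuous_pair; last exact: continuous_snd.
  by apply: comp_continuous ck; exact: continuous_fst.
have [|y Yy ky] := ak u; first by exists x => //; exact: cluster_cvg.
apply: (aH (fun n => (k (u n), s n))); exists (y, t) => //.
exact: cluster_cvg_pair.
Qed.

Lemma interval_eq0_or_gt0 (R : realType) (t : unit_interval R) :
  t = I0 R \/ 0 < set_val t.
Proof.
by have [t0|t0] := pselect (0 < set_val t); [right|left; exact: interval_eq0].
Qed.

Section Flow.
Variables (R : realType) (M : topologicalType) (X : set M).
Variables (h : (M * unit_interval R)%type -> M) (tau : M -> unit_interval R).
Hypotheses (ch : continuous h) (h0 : forall x, h (x, I0 R) = x).
Hypothesis hX : forall x t, 0 < set_val t -> ~ X (h (x, t)).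
Hypotheses (ctau : continuous tau) (tau0 : forall x, X x -> tau x = I0 R).

(** Flowing for time [tau x] extends continuously by the identity on [X], and so does the homotopy
    that scales the time by [s]. Off [X] it remains off [X]: the scaled time is either 0, when the
    point does not move, or positive. *)
Lemma flow_approaching_homotopic (kappa : ~` X -> ~` X) :
  (forall p, set_val (kappa p) = h (set_val p, tau (set_val p))) ->
  approaching kappa /\ approaching_homotopic R idfun kappa.
Proof.
move=> hk; split.
  apply: (approaching_of_continuous (g := fun x => h (x, tau x))) => //.
    by apply: comp_continuous ch; apply: continuous_pair ctau; move=> x; exact: cvg_id.
  by move=> x Xx; rewrite tau0// h0.
pose K (xs : M * unit_interval R) := h (xs.1, interval_mul xs.2 (tau xs.1)).
have cK : continuous K.
  apply: comp_continuous ch; apply: continuous_pair; first exact: continuous_fst.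
  apply: (@comp_continuous _ _ _
    (fun xs : M * unit_interval R => (xs.2, tau xs.1)) _ _
    (@interval_mul_continuous R)).
  apply: continuous_pair; first exact: continuous_snd.
  by apply: comp_continuous ctau; exact: continuous_fst.
have [|H HK] := @lift_map _ _ X
    (fun ps : (~` X * unit_interval R)%type => K (set_val ps.1, ps.2)).
  move=> [p s]; rewrite /K /=.
  have [->|] := interval_eq0_or_gt0 (interval_mul s (tau (set_val p))); last exact: hX.
  by rewrite h0; exact: set_valP p.
exists H; split=> [|p|p].
- apply: (approaching_homotopy_of_continuous cK) => [p s|x s Xx].
    by rewrite HK.
  by rewrite /K /= tau0// /interval_mul set_val_I0 mulr0 clamp0 h0.
- apply: set_val_inj; rewrite HK /K /= /interval_mul set_val_I0.
  by rewrite mul0r clamp0 h0.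
- apply: set_val_inj; rewrite HK hk /K /= /interval_mul set_val_I1.
  by rewrite mul1r clampK.
Qed.

End Flow.

(** * Pushing along a homotopy to make a map approaching *)

Section Push.
Variables (R : realType) (M A B : topologicalType).
Variables (dA : A -> A -> R) (dB : B -> B -> R).
Hypotheses (hdA : is_metric dA) (hdB : is_metric dB).
Variables (X : set M) (XA : set A) (Y : set B) (i : M -> A).
Hypotheses (emb_i : embedding i) (cXA : closed XA) (XAE : XA = i @` X).
Variables (H : (A * unit_interval R)%type -> A).
Variables (h : (M * unit_interval R)%type -> M).
Hypotheses (cH : continuous H) (H0 : forall z, H (z, I0 R) = z).
Hypothesis HX : forall z t, 0 < set_val t -> ~ XA (H (z, t)).
Hypothesis Hh : forall m t, H (i m, t) = i (h (m, t)).
Variable iX : ~` X -> ~` XA.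
Hypothesis iXE : forall p, set_val (iX p) = i (set_val p).

Let hX m t : 0 < set_val t -> ~ X (h (m, t)).
Proof.
move=> t0 Xh; apply: (HX (z := i m) t0).
by rewrite Hh XAE; exists (h (m, t)).
Qed.

Variable Phi : (~` XA * unit_interval R)%type -> ~` Y.
Hypothesis cPhi : continuous Phi.
Hypothesis aPhi : approaching_homotopy (fun ps => Phi (iX ps.1, ps.2)).

(** Where [Phi] is within [e] of a value on [M] minus [X], at a point within [e] and at the same
    second coordinate. *)
Let U (e : R) : set (~` XA * unit_interval R) :=
  [set zs | exists p : ~` X, dA (set_val zs.1) (i (set_val p)) < e /\
    dB (set_val (Phi zs)) (set_val (Phi (iX p, zs.2))) < e].

Let nbhs_U e p (s : unit_interval R) : 0 < e -> nbhs (iX p, s) (U e).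
Proof.
move=> e0; have e20 : 0 < e / 2 by rewrite divr_gt0.
have cval : continuous (set_val \o Phi).
  exact: comp_continuous cPhi (@set_val_continuous _ _).
have cp : continuous (fun zs : (~` XA * unit_interval R)%type =>
    set_val (Phi (iX p, zs.2))).
  apply: (comp_continuous _ cval); apply: continuous_pair; last exact: continuous_snd.
  exact: cst_continuous.
have cf : continuous (fun zs : (~` XA * unit_interval R)%type => set_val zs.1).
  by apply: comp_continuous (@set_val_continuous _ _); exact: continuous_fst.
have /(cvg_metricP hdA)/(_ _ e0) h1 := cf (iX p, s).
have /(cvg_metricP hdB)/(_ _ e20) h2 := cval (iX p, s).
have /(cvg_metricP hdB)/(_ _ e20) h3 := cp (iX p, s).
apply: filterS (filterI h1 (filterI h2 h3)) => zs /= [k1 [k2 k3]].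
exists p; split; first by move: k1; rewrite iXE (metricC hdA).
have := metric_tri hdB (set_val (Phi zs)) (set_val (Phi (iX p, s)))
  (set_val (Phi (iX p, zs.2))).
by rewrite (metricC hdB (set_val (Phi zs)) (set_val (Phi (iX p, s)))); lra.
Qed.

(* Keeps H at times bounded away from 0, so that it takes values off XA. *)
Let step n (t : unit_interval R) := clamp (Num.max (set_val t) n.+1%:R^-1).

Let stepE n t : set_val (step n t) = Num.max (set_val t) n.+1%:R^-1.
Proof.
apply: clampE; have /andP[t0 t1] := interval_itv t.
by rewrite le_max t0 ge_max t1 /= invf_le1 ?ler1n// ltr0n.
Qed.

Let step_gt0 n t : 0 < set_val (step n t).
Proof. by rewrite stepE lt_max invr_gt0 ltr0n orbT. Qed.

Let step_continuous n : continuous (step n).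
Proof.
apply/(continuous_metricP _ (interval_metric R) (interval_metric R)) => x e e0.
exists e => // y xy; rewrite !stepE; apply: le_lt_trans xy.
by apply: dist_max; rewrite // subrr normr0.
Qed.

(** [Phi] is controlled only along [M] minus [X]. Since [H] moves [i m] within the image of [M], for
    times bounded away from 0 it carries points close to [X] to points where [Phi] is controlled.
    With [tau] adapted to these neighbourhoods, [Phi (kappa z, s)] is within [tau z] of a value on
    [M] minus [X], and [tau z] tends to 0 at [XA]. *)
Lemma push_approaching : exists tau : A -> unit_interval R,
  [/\ continuous tau, forall x, XA x -> tau x = I0 R,
      forall z, ~ XA z -> 0 < set_val (tau z)
    & forall kappa : ~` XA -> ~` XA,
        (forall p, set_val (kappa p) = H (set_val p, tau (set_val p))) ->
        approaching_homotopy (fun zs => Phi (kappa zs.1, zs.2))].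
Proof.
have /choice[Hn HnE] : forall n : nat, exists G : A * unit_interval R -> ~` XA,
    forall zt, set_val (G zt) = H (zt.1, step n zt.2).
  by move=> n; apply: lift_map => -[z t]; exact/HX/step_gt0.
have cHn n : continuous (Hn n).
  have cst : continuous (fun zt : A * unit_interval R => step n zt.2).
    move=> zt; apply: (@continuous_comp _ _ _ snd (step n)); first exact: cvg_snd.
    exact: step_continuous.
  apply: continuous_set_type.
  rewrite (_ : _ \o _ = H \o (fun zt => (zt.1, step n zt.2))).
    apply: comp_continuous cH; apply: continuous_pair; first exact: continuous_fst.
    exact: cst.
  by apply/funext => zt /=; rewrite HnE.
pose G n : set A := [set z | forall ts : unit_interval R * unit_interval R,
  U n.+1%:R^-1 (Hn n (z, ts.1), ts.2)].
have nG n x : XA x -> nbhs x (G n).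
  rewrite XAE => -[m Xm <-].
  (* The tube lemma over the compact square of flow times and homotopy parameters: it suffices to
     treat each pair [(t, s)] near [i m]. *)
  have /compact_near_coveringP/(_ _ (nbhs (i m))) cover :=
    compact_setX (@interval_compact R) (@interval_compact R).
  have := cover (fun z ts => U n.+1%:R^-1 (Hn n (z, ts.1), ts.2)) _.
  rewrite setXTT => near_cover.
  apply: filterS (near_cover (nbhs_filter (i m)) _) => [z Uz ts|[t s] _].
    exact: Uz.
  (* On the image of [M] the flow [H] is [h], so at [i m] it reaches a point of [M] minus [X],
     around which [nbhs_U] applies. *)
  pose p : ~` X := lift_off (hX (m := m) (step_gt0 n t)).
  have Hnp : Hn n (i m, t) = iX p.
    by apply: set_val_inj; rewrite HnE iXE /= Hh.
  have cf : continuous (fun tsz : (unit_interval R * unit_interval R) * A =>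
      (Hn n (tsz.2, tsz.1.1), tsz.1.2)).
    apply: continuous_pair.
      apply: (comp_continuous _ (cHn n)); apply: continuous_pair.
        exact: continuous_snd.
      exact: (comp_continuous (@continuous_fst _ _) (@continuous_fst _ _)).
    exact: (comp_continuous (@continuous_fst _ _) (@continuous_snd _ _)).
  apply: (cf ((t, s), i m)) => /=; rewrite Hnp; apply: nbhs_U.
  by rewrite invr_gt0 ltr0n.
have mA : metrizable R A by exists dA.
have [tau [ctau tau0 tau_gt0 tauG]] := vanishing_function mA cXA nG.
exists tau; split=> // kappa kappaE.
have ckappa : continuous kappa.
  apply: continuous_set_type.
  rewrite (_ : _ \o _ = (fun z => H (z, tau z)) \o set_val); last first.
    by apply/funext => z /=; rewrite kappaE.
  apply: comp_continuous; first exact: set_val_continuous.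
  by apply: comp_continuous cH; apply: continuous_pair ctau; move=> x; exact: cvg_id.
apply: approaching_homotopyI => // [|u s x t XAx ux st].
  apply: (comp_continuous _ cPhi); apply: continuous_pair; last exact: continuous_snd.
  by apply: comp_continuous ckappa; exact: continuous_fst.
have [N _ hN] : \forall n \near \oo, ~ XA (set_val (u n)) ->
    exists2 k, G k (set_val (u n)) & k.+1%:R^-1 <= set_val (tau (set_val (u n))).
  exact: ux _ (tauG x XAx).
(* Shifting by [N] discards the indices at which the sequence is not yet in the neighbourhood given
   by [tauG]. *)
pose phi n := (n + N)%N; have phin n : (n <= phi n)%N by exact: leq_addr.
pose r n := set_val (tau (set_val (u (phi n)))).
have /choice[p pP] : forall n, exists p : ~` X,
    dA (set_val (kappa (u (phi n)))) (i (set_val p)) <= r n /\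
    dB (set_val (Phi (kappa (u (phi n)), s (phi n))))
       (set_val (Phi (iX p, s (phi n)))) <= r n.
  move=> n; have [k Gk hk] := hN (phi n) (leq_addl _ _) (set_valP (u (phi n))).
  have [p [/= h1 h2]] := Gk (tau (set_val (u (phi n))), s (phi n)).
  (* As [tau] is at least [k.+1%:R^-1] here, [step k] leaves this time unchanged, and [Hn k] agrees
     with [kappa]. *)
  have Ek : Hn k (set_val (u (phi n)), tau (set_val (u (phi n)))) = kappa (u (phi n)).
    apply: set_val_inj; rewrite HnE kappaE /=.
    by rewrite /step max_l// clampK.
  exists p; rewrite -Ek; split; apply: le_trans hk; exact: ltW.
have uphi := cvg_subseq phin ux.
have sphi := cvg_subseq phin st.
have r0 : r @ \oo --> (0 : R).
  have ctv : continuous (set_val \o tau : A -> R).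
    by move=> z; apply: continuous_comp; [exact: ctau|exact: set_val_continuous].
  have e0 : (set_val \o tau : A -> R) x = 0 by rewrite /= tau0.
  by rewrite -e0; exact: (cvg_comp _ _ uphi (ctv x)).
have kx : (fun n => set_val (kappa (u (phi n)))) @ \oo --> x.
  have cF : continuous (fun z => H (z, tau z)).
    by apply: comp_continuous cH; apply: continuous_pair ctau; move=> z; exact: cvg_id.
  have := cvg_comp _ _ uphi (cF x); rewrite tau0// H0 => hx.
  by move: hx; congr (_ @ \oo --> x); apply/funext => n /=; rewrite kappaE.
have ipx : (fun n => i (set_val (p n))) @ \oo --> x.
  by apply: (cvg_dist hdA kx r0) => n; have [] := pP n.
have [m Xm imx] : (i @` X) x by rewrite -XAE.
rewrite -imx in ipx.
have pm : set_val \o p @ \oo --> m.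
  exact: (@embedding_cvg _ _ i _ _ _ (set_val \o p) m emb_i ipx).
(* The companion points [p n] converge to [m] in [X], so their values cluster in [Y]; the actual
   values differ from them by at most [r n], which tends to 0. *)
have [|y Yy cy] := aPhi.2 (fun n => (p n, s (phi n))).
  exists (m, t) => //; exact: (cluster_cvg_pair (cluster_cvg pm) sphi).
exists y => //; apply: (cluster_subseq phin).
apply: (cluster_dist hdB cy r0) => n; rewrite (metricC hdB).
by have [] := pP n.
Qed.

End Push.

Lemma embedding_of_comp (S T W : topologicalType) (e : S -> T) (k : T -> W) :
  embedding (k \o e) -> continuous e -> continuous k -> embedding e.
Proof.
move=> [inj op] /continuousP ce /continuousP ck; split=> [x y exy|U].
  by apply: inj; rewrite /= exy.
split=> [/op[V oV ->]|[V oV ->]]; last exact: ce.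
by exists (k @^-1` V) => //; exact: ck.
Qed.

(** The cone over any set contains the constant function 1, and it retracts onto [B]. The point
    obtained serves as a default value in [embedding_lift]. *)
Lemma absolute_retract_inhabited (R : realType) (B : topologicalType) :
  absolute_retract R B -> exists b : B, True.
Proof.
move=> [[d hd] retr]; have hb := bounded_metric hd.
set db := (fun x y => _) in hb.
have db1 x y : db x y <= 1 by rewrite ge_min lexx.
have mc : metrizable R (cone db) by eexists; exact: cone_metric.
have [r _ _] := retr _ _ mc (cone_base_embedding hb db1)
  (@cone_base_closed _ _ _ hb db1).
by exists (r (exist _ _ (cone_const_subproof db))).
Qed.

(** * Extending approaching maps to an ambient absolute retract *)

Section AmbientExtension.
Variables (R : realType) (M A B : topologicalType) (X : set M) (XA : set A).
Variables (Y : set B) (i : M -> A).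
Hypotheses (arA : absolute_retract R A) (arB : absolute_retract R B).
Hypotheses (emb_i : embedding i) (cl_i : closed (range i)).
Hypotheses (cX : closed X) (XAE : XA = i @` X).
Hypotheses (nX : homotopy_negligible R X) (nXA : homotopy_negligible R XA).
Hypothesis nY : homotopy_negligible R Y.
Variable iX : ~` X -> ~` XA.
Hypothesis iXE : forall p, set_val (iX p) = i (set_val p).

Let mA : metrizable R A. Proof. by case: arA. Qed.

Let cXA : closed XA. Proof. by rewrite XAE; exact: embedding_closed. Qed.

Let XA_i m : XA (i m) -> X m.
Proof. by rewrite XAE => -[m' Xm' /emb_i.1 <-]. Qed.

(** The flow is prescribed on the closed union of the copy of [M] times the interval and the bottom
    level, then extended by [push_extension]. At positive times it avoids [XA] by [hX] on the copy
    of [M] and by the push elsewhere. *)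
Lemma ambient_flow (h : (M * unit_interval R)%type -> M) :
  continuous h -> (forall x, h (x, I0 R) = x) ->
  (forall x t, 0 < set_val t -> ~ X (h (x, t))) ->
  exists H : (A * unit_interval R)%type -> A,
    [/\ continuous H, forall z, H (z, I0 R) = z,
        forall z t, 0 < set_val t -> ~ XA (H (z, t))
      & forall m t, H (i m, t) = i (h (m, t))].
Proof.
move=> ch h0 hX; pose ii (mt : M * unit_interval R) := (i mt.1, mt.2).
have emb_ii : embedding ii by exact: embedding_prod.
pose D : set (A * unit_interval R)%type := [set zt | set_val zt.2 <= 0 :> R].
have cD : closed D.
  exact: (closed_preimage (@height_continuous R A) (@closed_le R 0)).
have cii : closed (range ii).
  have -> : range ii = fst @^-1` (range i).
    apply/seteqP; split=> [_ [[m t] _ <-]|[z t] [m _ imz]] /=; first by exists m.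
    by exists (m, t) => //; rewrite /ii /= imz.
  by apply: closed_preimage cl_i; exact: continuous_fst.
have [f [fi fD]] := embedding_lift (i \o h) fst emb_ii.1.
(* The two prescriptions agree on the overlap because [h] starts at the identity. *)
have fDE zt : D zt -> f zt = zt.1.
  move=> Dz; have [[[m t] _ mz]|] := pselect (range ii zt); last exact: fD.
  have t0 : t = I0 R.
    by apply: interval_eq0 => t_gt0; move: Dz; rewrite -mz /D /= leNgt t_gt0.
  by rewrite -mz fi t0 /= h0.
have cf : {within range ii `|` D, continuous f}.
  apply: withinU_continuous => //.
    apply: (embedding_within emb_ii _ fi).
    by apply: comp_continuous ch _; exact: embedding_continuous.
  apply: (@within_eq _ _ D fst f) => [zt Dz|]; first by rewrite fDE.
  by apply: continuous_subspaceT; exact: continuous_fst.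
have mAI : metrizable R (A * unit_interval R)%type.
  by apply: metrizable_prod => //; exact: metrizable_interval.
have [F [cF Ff Foff]] := push_extension arA mAI (closedU cii cD) cf nXA.
have Fi m t : F (i m, t) = i (h (m, t)).
  rewrite Ff; first by rewrite -[(i m, t)]/(ii (m, t)) fi.
  by left; exists (m, t).
exists F; split=> // [z|z t t0].
  by rewrite Ff ?fDE//; [rewrite /D /=|right; rewrite /D /=].
have [[[m s] _ [imz _]]|nr] := pselect (range ii (z, t)); last first.
  by apply: Foff => -[//|]; rewrite /D /= leNgt t0.
by rewrite -imz Fi => /XA_i; exact: hX.
Qed.

Lemma sub_embedding : embedding iX.
Proof.
have iXE' : set_val \o iX = i \o set_val by apply/funext => p /=; rewrite iXE.
have emb : embedding (set_val \o iX).
  by rewrite iXE'; apply: embedding_comp emb_i; exact: set_val_embedding.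
apply: (embedding_of_comp emb); last exact: set_val_continuous.
by apply: continuous_set_type; exact: embedding_continuous.
Qed.

Lemma sub_range : range iX = set_val @^-1` (range i).
Proof.
apply/seteqP; split=> [_ [p _ <-]|z [m _ imz]] /=.
  by rewrite iXE; exists (set_val p).
have nXm : ~ X m.
  move=> Xm; have nz : ~ XA (set_val z) := set_valP z.
  by apply: nz; rewrite -imz XAE; exists m.
exists (lift_off nXm) => //; apply: val_inj.
by rewrite -[LHS]/(set_val _) -[RHS]/(set_val _) iXE.
Qed.

Lemma sub_closed : closed (range iX).
Proof.
by rewrite sub_range; apply: closed_preimage cl_i; exact: set_val_continuous.
Qed.

(** A continuous extension [Phi] of [f] off [Y] exists since [M] minus [X] is closed in [A] minus
    [XA]. Precomposing it with the flow [kA] makes it approaching. On [M] minus [X] the result is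
    [f] precomposed with the flow [kM] of [M] for the same time, so [f] is recovered up to
    approaching homotopy. *)
Lemma approaching_extension (f : ~` X -> ~` Y) : approaching f ->
  exists F : ~` XA -> ~` Y,
    approaching F /\ approaching_homotopic R f (F \o iX).
Proof.
move=> af; have [h [ch h0 hX]] := nX.
have [H [cH H0 HX Hh]] := ambient_flow ch h0 hX.
have [b0 _] := absolute_retract_inhabited arB.
have [g [giX _]] := embedding_lift (set_val \o f) (fun=> b0) sub_embedding.1.
have cg : {within range iX, continuous g}.
  apply: (embedding_within sub_embedding _ giX).
  by apply: comp_continuous; [exact: af.1|exact: set_val_continuous].
have [F0 [cF0 F0g F0off]] := push_extension arB (metrizable_sub _ mA) sub_closed cg nY.
have F0Y z : ~ Y (F0 z).
  have [[p _ <-]|] := pselect (range iX z); last exact: F0off.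
  by rewrite F0g ?giX; [exact: set_valP (f p)|exists p].
have [Phi PhiE] := lift_map F0Y.
have cPhi : continuous Phi.
  apply: continuous_set_type; rewrite (_ : _ \o _ = F0)//.
  by apply/funext => z /=; rewrite PhiE.
have PhiiX p : Phi (iX p) = f p.
  apply: set_val_inj; rewrite PhiE F0g ?giX//.
have [dA hdA0] := mA; have hdA : is_metric dA := hdA0.
have [[dB hdB0] _] := arB; have hdB : is_metric dB := hdB0.
(* The parametrized statement is applied to a family constant in the parameter. *)
have [||tau [ctau tau0 tau_gt0 push]] := push_approaching hdA hdB emb_i cXA XAE
  cH H0 HX Hh iXE (Phi := fun zs => Phi zs.1).
- by apply: comp_continuous cPhi; exact: continuous_fst.
- rewrite (_ : (fun ps => _) = fun ps => f ps.1); first exact: approaching_cst_homotopy.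
  by apply/funext => ps /=; rewrite PhiiX.
have koff (z : ~` XA) : ~ XA (H (set_val z, tau (set_val z))).
  apply: HX; apply: tau_gt0; exact: set_valP z.
have [kA kAE] := lift_map koff.
have tau_i m : X m -> tau (i m) = I0 R by move=> Xm; apply: tau0; rewrite XAE; exists m.
have hkX (p : ~` X) : ~ X (h (set_val p, tau (i (set_val p)))).
  apply: hX; apply: tau_gt0 => /XA_i; exact: set_valP p.
have [kM kME] := lift_map hkX.
exists (Phi \o kA); split; first exact: (approaching_slice (I0 R) (push kA kAE)).
have ctau_i : continuous (tau \o i).
  by apply: comp_continuous ctau; exact: embedding_continuous.
have [_ idk] := flow_approaching_homotopic ch h0 hX ctau_i tau_i kME.
(* Compatibility of [H] with [h] gives [kA (iX p) = iX (kM p)], and [Phi] is [f] there. *)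
have := approaching_homotopic_comp_l af idk.
congr (approaching_homotopic _ _ _); apply/funext => p /=; rewrite -PhiiX; congr Phi.
apply: set_val_inj; rewrite iXE kME kAE iXE.
by rewrite Hh.
Qed.

(** The homotopy given on [M] minus [X], with [F] at time 0 and [F'] at time 1, is a map on a closed
    subset of [A] minus [XA] times the interval. Its extension off [Y], pushed by the flow [k], is
    an approaching homotopy from [F \o k] to [F' \o k]; and [k] is approaching homotopic to the
    identity. *)
Lemma approaching_extension_unique (F F' : ~` XA -> ~` Y) :
  approaching F -> approaching F' ->
  approaching_homotopic R (F \o iX) (F' \o iX) -> approaching_homotopic R F F'.
Proof.
move=> aF aF' [phi [aphi phi0 phi1]]; have [h [ch h0 hX]] := nX.
have [H [cH H0 HX Hh]] := ambient_flow ch h0 hX.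
pose ii (ps : ~` X * unit_interval R) := (iX ps.1, ps.2).
have emb_ii : embedding ii by apply: embedding_prod; exact: sub_embedding.
pose D (t : R) : set (~` XA * unit_interval R)%type := [set zs | set_val zs.2 = t].
have cD t : closed (D t) by exact: closed_level.
have cii : closed (range ii).
  have -> : range ii = fst @^-1` (range iX).
    apply/seteqP; split=> [_ [[p s] _ <-]|[z s] [p _ imz]] /=; first by exists p.
    by exists (p, s) => //; rewrite /ii /= imz.
  by apply: closed_preimage sub_closed; exact: continuous_fst.
(* Off the copy of [M] only the two end levels matter; the value at intermediate times is a
   placeholder. *)
pose g0 (zs : ~` XA * unit_interval R) :=
  if (set_val zs.2 : R) == 1 then set_val (F' zs.1) else set_val (F zs.1).
have [g [gi gD]] := embedding_lift (set_val \o phi) g0 emb_ii.1.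
have I0E (s : unit_interval R) : set_val s = 0 :> R -> s = I0 R.
  by move=> s0; apply: interval_eq0; rewrite s0 ltxx.
have I1E (s : unit_interval R) : set_val s = 1 :> R -> s = I1 R.
  by move=> s1; rewrite -(clampK s) s1 clamp1.
have g_0 zs : D 0 zs -> g zs = set_val (F zs.1).
  rewrite /D /= => s0; have [[[p s] _ pz]|nr] := pselect (range ii zs).
    by move: s0; rewrite -pz gi /= => /I0E ->; rewrite phi0.
  by rewrite gD// /g0 s0 eq_sym oner_eq0.
have g_1 zs : D 1 zs -> g zs = set_val (F' zs.1).
  rewrite /D /= => s1; have [[[p s] _ pz]|nr] := pselect (range ii zs).
    by move: s1; rewrite -pz gi /= => /I1E ->; rewrite phi1.
  by rewrite gD// /g0 s1 eqxx.
have cfst (K : ~` XA -> ~` Y) : approaching K ->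
    continuous (fun zs : ~` XA * unit_interval R => set_val (K zs.1)).
  move=> aK zs; apply: (@continuous_comp _ _ _ fst (set_val \o K)).
    exact: cvg_fst.
  by apply: continuous_comp; [exact: aK.1|exact: set_val_continuous].
have cg : {within (range ii `|` D 0) `|` D 1, continuous g}.
  apply: withinU_continuous => //; [exact: closedU|apply: withinU_continuous => //|].
  - apply: (embedding_within emb_ii _ gi).
    by apply: comp_continuous; [exact: aphi.1|exact: set_val_continuous].
  - apply: (@within_eq _ _ (D 0) (fun zs => set_val (F zs.1))).
      by move=> zs /g_0.
    by apply: continuous_subspaceT; exact: cfst.
  - apply: (@within_eq _ _ (D 1) (fun zs => set_val (F' zs.1))).
      by move=> zs /g_1.
    by apply: continuous_subspaceT; exact: cfst.
have mAI : metrizable R (~` XA * unit_interval R)%type.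
  by apply: metrizable_prod; [exact: metrizable_sub|exact: metrizable_interval].
have [G0 [cG0 G0g G0off]] :=
  push_extension arB mAI (closedU (closedU cii (cD 0)) (cD 1)) cg nY.
have G0Y zs : ~ Y (G0 zs).
  have [C|] := pselect (((range ii `|` D 0) `|` D 1) zs); last exact: G0off.
  rewrite G0g//; case: C => [[[ps _ <-]|/g_0 ->]|/g_1 ->].
  - by rewrite gi; exact: (set_valP (phi ps)).
  - exact: (set_valP (F zs.1)).
  - exact: (set_valP (F' zs.1)).
have [Phi PhiE] := lift_map G0Y.
have cPhi : continuous Phi.
  apply: continuous_set_type; rewrite (_ : _ \o _ = G0)//.
  by apply/funext => z /=; rewrite PhiE.
have [dA hdA0] := mA; have hdA : is_metric dA := hdA0.
have [[dB hdB0] _] := arB; have hdB : is_metric dB := hdB0.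
have [|tau [ctau tau0 tau_gt0 push]] := push_approaching hdA hdB emb_i cXA XAE
  cH H0 HX Hh iXE cPhi.
  rewrite (_ : (fun ps => _) = phi)//; apply/funext => -[p s] /=.
  apply: set_val_inj; rewrite PhiE G0g.
    by rewrite -[(iX p, s)]/(ii (p, s)) gi.
  by left; left; exists (p, s).
have koff (z : ~` XA) : ~ XA (H (set_val z, tau (set_val z))).
  apply: HX; apply: tau_gt0; exact: set_valP z.
have [k kE] := lift_map koff.
have [ak idk] := flow_approaching_homotopic cH H0 HX ctau tau0 kE.
have Fk := approaching_homotopic_comp_l aF idk.
have F'k := approaching_homotopic_comp_l aF' idk.
have mid : approaching_homotopic R (F \o k) (F' \o k).
  exists (fun zs => Phi (k zs.1, zs.2)); split; first exact: push.
    move=> z; apply: set_val_inj; rewrite PhiE G0g ?g_0//.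
    by left; right.
  move=> z; apply: set_val_inj; rewrite PhiE G0g ?g_1//.
  by right.
apply: (approaching_homotopic_trans mA Fk).
by apply: (approaching_homotopic_trans mA mid); exact: approaching_homotopic_sym.
Qed.

End AmbientExtension.

(** * The fine shape category *)

Section Realizes.
Variables (R : realType) (X Y : topologicalType).
Variables (A : z_embedding R X) (B : z_embedding R Y).

Lemma z_metrizable : metrizable R A.
Proof. by case: (z_spaceAR A). Qed.

(** Extend [phi] from the closed copy of [X]; the push makes the extension send the complement of
    the copy of [X] off that of [Y]. *)
Lemma realizes_exists (phi : X -> Y) : continuous phi ->
  exists F : ~` z_set A -> ~` z_set B, realizes phi F.
Proof.
move=> cphi; have [b0 _] := absolute_retract_inhabited (z_spaceAR B).
have [g [gE _]] := embedding_lift (z_map B \o phi) (fun=> b0) (z_mapE A).1.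
have cg : {within range (z_map A), continuous g}.
  apply: (embedding_within (z_mapE A) _ gE); apply: comp_continuous cphi _.
  exact/embedding_continuous/z_mapE.
have [G [cG Gg Goff]] := push_extension (z_spaceAR B) z_metrizable
  (@z_closed _ _ A) cg (@z_negligible _ _ B).
have GA x : G (z_map A x) = z_map B (phi x) by rewrite Gg; [exact: gE|exists x].
have koff (p : ~` z_set A) : ~ z_set B (G (set_val p)).
  by apply: Goff; exact: set_valP p.
have [F FE] := lift_map koff.
exists F; split; last by exists G; split=> // p; rewrite FE.
apply: (approaching_of_continuous cG) => // _ [x _ <-].
by rewrite GA; exists (phi x).
Qed.

(** Both continuous extensions restrict to [phi] on [X], so the homotopy constant on [X] is
    consistent with [G] and [G'] at the ends; [push_extension] fills in the rest off [Y]. *)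
Lemma realizes_unique (phi : X -> Y) (F F' : ~` z_set A -> ~` z_set B) :
  realizes phi F -> realizes phi F' -> approaching_homotopic R F F'.
Proof.
move=> [_ [G [cG GA GF]]] [_ [G' [cG' G'A G'F]]].
pose D (t : R) : set (A * unit_interval R)%type := [set zs | set_val zs.2 = t].
have cD t : closed (D t) by exact: closed_level.
pose XI : set (A * unit_interval R)%type := fst @^-1` z_set A.
have cXI : closed XI.
  by apply: closed_preimage; [exact: continuous_fst|exact: z_closed].
pose f (zs : A * unit_interval R) :=
  if (set_val zs.2 : R) == 1 then G' zs.1 else G zs.1.
have f1 zs : D 1 zs -> f zs = G' zs.1 by rewrite /D /f /= => ->; rewrite eqxx.
have f0 zs : (XI `|` D 0) zs -> f zs = G zs.1.
  case=> [[x _ xz]|]; rewrite /f; last by rewrite /D /= => ->; rewrite eq_sym oner_eq0.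
  by case: eqP => // _; rewrite -xz GA G'A.
have cf : {within (XI `|` D 0) `|` D 1, continuous f}.
  apply: withinU_continuous => //; first exact: closedU.
    apply: (@within_eq _ _ (XI `|` D 0) (G \o fst)) => [zs /f0//|].
    by apply: continuous_subspaceT; apply: comp_continuous cG; exact: continuous_fst.
  apply: (@within_eq _ _ (D 1) (G' \o fst)) => [zs /f1//|].
  by apply: continuous_subspaceT; apply: comp_continuous cG'; exact: continuous_fst.
have mAI : metrizable R (A * unit_interval R)%type.
  by apply: metrizable_prod; [exact: z_metrizable|exact: metrizable_interval].
have [K [cK Kf Koff]] := push_extension (z_spaceAR B) mAI
  (closedU (closedU cXI (cD 0)) (cD 1)) cf (@z_negligible _ _ B).
have K0 z : K (z, I0 R) = G z by rewrite Kf ?f0//; [right|left; right].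
have K1 z : K (z, I1 R) = G' z by rewrite Kf ?f1//; right.
have koff (ps : ~` z_set A * unit_interval R) : ~ z_set B (K (set_val ps.1, ps.2)).
  case: ps => p s /=; have [C|] := pselect (((XI `|` D 0) `|` D 1) (set_val p, s)).
    case: C => [[XIp|s0]|s1].
    - by case: (set_valP p).
    - have -> : s = I0 R by apply: val_inj.
      by rewrite K0 GF; exact: (set_valP (F p)).
    - have -> : s = I1 R by apply: val_inj.
      by rewrite K1 G'F; exact: (set_valP (F' p)).
  exact: Koff.
have [H HE] := lift_map koff.
exists H; split=> [|p|p].
- apply: (approaching_homotopy_of_continuous cK) => [p s|_ s [x _ <-]].
    by rewrite HE.
  rewrite Kf; last by left; left; exists x.
  by rewrite f0; [rewrite /= GA; exists (phi x)|left; exists x].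
- by apply: set_val_inj; rewrite HE K0 GF.
- by apply: set_val_inj; rewrite HE K1 G'F.
Qed.

End Realizes.

Lemma realizes_id (R : realType) (X : topologicalType) (A : z_embedding R X) :
  realizes idfun (idfun : ~` z_set A -> ~` z_set A).
Proof.
split; first exact: approaching_id.
by exists idfun; split=> // x; exact: cvg_id.
Qed.

Lemma realizes_comp (R : realType) (X : topologicalType)
    (A B C : z_embedding R X) (a : ~` z_set A -> ~` z_set B)
    (b : ~` z_set B -> ~` z_set C) :
  realizes idfun a -> realizes idfun b -> realizes idfun (b \o a).
Proof.
move=> [aa [G [cG GA Ga]]] [ab [G' [cG' G'B G'b]]]; split.
  exact: approaching_comp.
exists (G' \o G); split=> [|x|p] /=; first exact: comp_continuous.
  by rewrite GA G'B.
by rewrite Ga G'b.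
Qed.

Section FineCategory.
Variable R : realType.

Lemma realizes_idfun_exists (X : topologicalType) (A B : z_embedding R X) :
  exists a : ~` z_set A -> ~` z_set B, realizes idfun a.
Proof. by apply: realizes_exists => x; exact: cvg_id. Qed.

Lemma same_fine_refl (X Y : topologicalType) (P : fine_rep R X Y) :
  same_fine_morphism P P.
Proof.
exists idfun, idfun; split; [exact: realizes_id|exact: realizes_id|].
exact/approaching_homotopic_refl/rep_approaching.
Qed.

Lemma same_fine_trans (X Y : topologicalType) (P Q S : fine_rep R X Y) :
  same_fine_morphism P Q -> same_fine_morphism Q S -> same_fine_morphism P S.
Proof.
move=> [a [b [ra rb ab]]] [a' [b' [ra' rb' ab']]].
exists (a' \o a), (b' \o b); split; [exact: realizes_comp|exact: realizes_comp|].
apply: (approaching_homotopic_trans (z_metrizable _)).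
  exact: (approaching_homotopic_comp_l rb'.1 ab).
exact: (approaching_homotopic_comp_r (z_metrizable _) ra.1 ab').
Qed.

(** By uniqueness of realizations of the identity, [a'] and [b'] are homotopy inverse to [a] and
    [b]. Writing [Q] and [P] for their maps, [b' Q] deforms to [b' Q a a'], then to [b' b P a'],
    then to [P a']. *)
Lemma same_fine_sym (X Y : topologicalType) (P Q : fine_rep R X Y) :
  same_fine_morphism P Q -> same_fine_morphism Q P.
Proof.
move=> [a [b [ra rb ab]]].
have [a' ra'] := realizes_idfun_exists (rep_src Q) (rep_src P).
have [b' rb'] := realizes_idfun_exists (rep_tgt Q) (rep_tgt P).
exists a', b'; split=> //; have mQ := z_metrizable (rep_src Q).
have aP := @rep_approaching _ _ _ P; have aQ := @rep_approaching _ _ _ Q.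
have aa' := realizes_unique (realizes_comp ra' ra) (realizes_id _).
have bb' := realizes_unique (realizes_comp rb rb') (realizes_id _).
apply: (@approaching_homotopic_trans _ _ _ _ _ (b' \o rep_map Q \o (a \o a'))) => //.
  apply: approaching_homotopic_sym.
  exact: (approaching_homotopic_comp_l (approaching_comp aQ rb'.1) aa').
apply: (@approaching_homotopic_trans _ _ _ _ _ (b' \o (b \o rep_map P) \o a')) => //.
  apply: (@approaching_homotopic_comp_r _ _ _ _ _ _ _ (b' \o (rep_map Q \o a))
    (b' \o (b \o rep_map P)) a' mQ ra'.1).
  exact/(approaching_homotopic_comp_l rb'.1)/approaching_homotopic_sym.
exact: (approaching_homotopic_comp_r mQ (approaching_comp ra'.1 aP) bb').
Qed.

(** The two hypotheses may compare the middle spaces by different maps [b] and [b']; both realize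
    the identity of [Y], so they are homotopic. *)
Lemma same_fine_comp (X Y Z : topologicalType) (A A' : z_embedding R X)
    (B B' : z_embedding R Y) (C C' : z_embedding R Z)
    (F : ~` z_set A -> ~` z_set B) (G : ~` z_set B -> ~` z_set C)
    (F' : ~` z_set A' -> ~` z_set B') (G' : ~` z_set B' -> ~` z_set C')
    (aF : approaching F) (aG : approaching G)
    (aF' : approaching F') (aG' : approaching G') :
  same_fine_morphism (FineRep aF) (FineRep aF') ->
  same_fine_morphism (FineRep aG) (FineRep aG') ->
  same_fine_morphism (FineRep (approaching_comp aF aG))
    (FineRep (approaching_comp aF' aG')).
Proof.
move=> [a [b [/= ra rb ab]]] [b' [c [/= rb' rc bc]]].
exists a, c; split=> //=; have mA := z_metrizable A.
apply: (@approaching_homotopic_trans _ _ _ _ _ (G' \o b' \o F)) => //.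
  exact: (approaching_homotopic_comp_r mA aF bc).
apply: (@approaching_homotopic_trans _ _ _ _ _ (G' \o b \o F)) => //.
  apply: (approaching_homotopic_comp_r mA aF).
  exact: (approaching_homotopic_comp_l aG' (realizes_unique rb' rb)).
exact: (approaching_homotopic_comp_l aG' ab).
Qed.

Definition fine_class_of (X Y : topologicalType) (P : fine_rep R X Y) :
    fine_morphism R X Y :=
  FineMorphism (ex_intro _ P (fun Q => iff_refl (same_fine_morphism P Q))).

Lemma fine_comp_id (X Y : topologicalType) (A : z_embedding R X)
    (B : z_embedding R Y) (F : ~` z_set A -> ~` z_set B)
    (G : ~` z_set B -> ~` z_set A) (aF : approaching F) (aG : approaching G) :
  approaching_homotopic R (G \o F) idfun ->
  forall Q, fine_comp (fine_class_of (FineRep aG)) (fine_class_of (FineRep aF)) Q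
    <-> fine_id Q.
Proof.
move=> GF Q.
have idGF : same_fine_morphism (id_rep A) (FineRep (approaching_comp aF aG)).
  exists idfun, idfun; split; [exact: realizes_id|exact: realizes_id|].
  exact: approaching_homotopic_sym.
split=> [[A' [B' [C' [F' [G' [aF' [aG' [/= sF sG sQ]]]]]]]]|[A' sQ]].
  exists A; apply: same_fine_trans idGF _; apply: same_fine_trans sQ.
  exact: same_fine_comp.
exists A, B, A, F, G, aF, aG; split; [exact: same_fine_refl|exact: same_fine_refl|].
apply: same_fine_trans (same_fine_sym idGF) _; apply: same_fine_trans sQ.
(* The same comparison map on source and target identifies the identities of [A] and [A']. *)
have [a ra] := realizes_idfun_exists A A'; exists a, a; split=> //.
exact/approaching_homotopic_refl/ra.1.
Qed.

End FineCategory.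

(** * The ambient absolute retracts and the resulting equivalence *)

Lemma metrizable_z_set (R : realType) (M : topologicalType) : metrizable R M ->
  exists (A : topologicalType) (i : M -> A),
    [/\ absolute_retract R A, embedding i, closed (range i)
      & homotopy_negligible R (range i)].
Proof.
move=> [d hd]; have hb := bounded_metric hd; set db := (fun x y => _) in hb.
have db1 x y : db x y <= 1 by rewrite ge_min lexx.
exists (cone db), (cone_base hb db1); split.
- exact: cone_AR.
- exact: cone_base_embedding.
- exact: cone_base_closed.
- exact: cone_base_negligible.
Qed.

Lemma homotopy_negligibleS (R : realType) (M : topologicalType) (X Y : set M) :
  X `<=` Y -> homotopy_negligible R Y -> homotopy_negligible R X.
Proof.
by move=> XY [h [ch h0 hY]]; exists h; split=> // x t t0 /XY; exact: hY.
Qed.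

(** The absolute retract is built around the whole of [M]; its closed subset [X] is then a Z-set
    because it lies in the Z-set [range i]. *)
Lemma ambient_z_embedding (R : realType) (M : topologicalType) (X : set M) :
  metrizable R M -> closed X ->
  exists (A : z_embedding R X) (i : M -> A),
    [/\ embedding i, closed (range i) & z_set A = i @` X].
Proof.
move=> mM cX; have [A [i [arA emb_i cl_i ni]]] := metrizable_z_set mM.
have XE : range (i \o set_val : X -> A) = i @` X.
  by rewrite -[in RHS](range_set_val X) image_comp.
have emb : embedding (i \o set_val : X -> A).
  by apply: embedding_comp emb_i; exact: set_val_embedding.
have cl : closed (range (i \o set_val : X -> A)).
  by rewrite XE; exact: embedding_closed.
have neg : homotopy_negligible R (range (i \o set_val : X -> A)).
  by apply: homotopy_negligibleS ni; rewrite XE => _ [x _ <-]; exists x.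
by exists (ZEmbedding arA emb cl neg), i.
Qed.

(** By uniqueness of extensions it suffices to compare on [M] minus [X], where [G F iX] deforms to
    [G iY f], then to [iX g f], then to [iX]. *)
Lemma extension_comp_id (R : realType) (M N : topologicalType)
    (X : set M) (Y : set N) (A : z_embedding R X) (B : z_embedding R Y)
    (i : M -> A) (iX : ~` X -> ~` z_set A) (iY : ~` Y -> ~` z_set B)
    (f : ~` X -> ~` Y) (g : ~` Y -> ~` X)
    (F : ~` z_set A -> ~` z_set B) (G : ~` z_set B -> ~` z_set A) :
  metrizable R M -> homotopy_negligible R X ->
  embedding i -> closed (range i) -> closed X -> z_set A = i @` X ->
  (forall p, set_val (iX p) = i (set_val p)) -> approaching iX ->
  approaching f -> approaching F -> approaching G ->
  approaching_homotopic R (iY \o f) (F \o iX) ->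
  approaching_homotopic R (iX \o g) (G \o iY) ->
  approaching_homotopic R (g \o f) idfun ->
  approaching_homotopic R (G \o F) idfun.
Proof.
move=> mM nX emb_i cl_i cX XE iXE aiX af aF aG hF hG gf.
apply: (approaching_extension_unique (z_spaceAR A) (z_spaceAR A) emb_i cl_i cX
  XE nX (@z_negligible _ _ A) (@z_negligible _ _ A) iXE).
- exact: approaching_comp.
- exact: approaching_id.
apply: (@approaching_homotopic_trans _ _ _ _ _ (G \o iY \o f)) => //.
  exact/approaching_homotopic_sym/(approaching_homotopic_comp_l aG hF).
apply: (@approaching_homotopic_trans _ _ _ _ _ (iX \o g \o f)) => //.
  exact/approaching_homotopic_sym/(approaching_homotopic_comp_r mM af hG).
exact: (approaching_homotopic_comp_l aiX gf).
Qed.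

Theorem theorem4 (R : realType) (M N : topologicalType)
    (X : set M) (Y : set N)
    (hM : metrizable R M) (hN : metrizable R N)
    (cX : closed X) (cY : closed Y)
    (nX : homotopy_negligible R X) (nY : homotopy_negligible R Y)
    (hXY : approaching_homotopy_equivalent R X Y) :
  fine_shape_equivalent R (set_type X) (set_type Y).
Proof.
have [f [g [af ag gf fg]]] := hXY.
have [A [i [emb_i cl_i XE]]] := ambient_z_embedding hM cX.
have [B [j [emb_j cl_j YE]]] := ambient_z_embedding hN cY.
have offX (p : ~` X) : ~ z_set A (i (set_val p)).
  have nXp : ~ X (set_val p) := set_valP p.
  by rewrite XE => -[x Xx /emb_i.1 xp]; apply: nXp; rewrite -xp.
have offY (p : ~` Y) : ~ z_set B (j (set_val p)).
  have nYp : ~ Y (set_val p) := set_valP p.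
  by rewrite YE => -[y Yy /emb_j.1 yp]; apply: nYp; rewrite -yp.
have [iX iXE] := lift_map offX; have [iY iYE] := lift_map offY.
have aiX : approaching iX.
  apply: (approaching_of_continuous (embedding_continuous emb_i)) => [p|x Xx].
    by rewrite iXE.
  by rewrite XE; exists x.
have aiY : approaching iY.
  apply: (approaching_of_continuous (embedding_continuous emb_j)) => [p|y Yy].
    by rewrite iYE.
  by rewrite YE; exists y.
(* The maps extended to the ambient spaces are [iY \o f] and [iX \o g], which take values in the
   complements of [Y] and [X] in the absolute retracts. *)
have [F [aF hF]] := approaching_extension (z_spaceAR A) (z_spaceAR B) emb_i cl_i
  cX XE nX (@z_negligible _ _ A) (@z_negligible _ _ B) iXE (approaching_comp af aiY).
have [G [aG hG]] := approaching_extension (z_spaceAR B) (z_spaceAR A) emb_j cl_j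
  cY YE nY (@z_negligible _ _ B) (@z_negligible _ _ A) iYE (approaching_comp ag aiX).
exists (fine_class_of (FineRep aF)), (fine_class_of (FineRep aG)); split.
  apply: fine_comp_id.
  exact: (extension_comp_id hM nX emb_i cl_i cX XE iXE aiX af aF aG hF hG gf).
apply: fine_comp_id.
exact: (extension_comp_id hN nY emb_j cl_j cY YE iYE aiY ag aG aF hG hF fg).
Qed.
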